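(* The maximal operator $S^\ast$, $S^\ast f(x)=\sup_{n\ge 1}|S_nf(x)|$, is of weak type $(1,1)$ with respect to $\mu$; that is, there exists a constant $C>0$ such that for all $f\in L^1(\mu)$ and all $\alpha>0$, $$\mu\bigl(\{x:|S^\ast f(x)|>\alpha\}\bigr)\le \frac{C}{\alpha}\,\|f\|_{L^1(\mu)}.$$ Consequently, for every $f\in L^1(\mu)$, $$\lim_{n\to\infty}S_nf(x)=f(x)$$ for $\mu$-almost every $x\in\mathrm{supp}(\mu)$.
   Context: $\mu=\mu_{1/4}$ is the Bernoulli convolution with ratio $1/4$: the probability measure on $\mathbb R$ that is the distribution of the random variable $\sum_{j=1}^\infty \xi_j4^{-j}$, where the $\xi_j$ are i.i.d. random variables taking the values $1$ and $-1$ with probability $1/2$ each. Equivalently, $\mu$ is the unique Borel probability measure on $\mathbb R$ with $\mu(\cdot)=\frac12\mu(\tau_1^{-1}(\cdot))+\frac12\mu(\tau_2^{-1}(\cdot))$, where $\tau_1(x)=\frac{x-1}{4}$ and $\tau_2(x)=\frac{x+1}{4}$. For $n\ge 1$ let $\Lambda_n=\bigl\{\sum_{j=0}^{n-1}c_j4^j: c_j\in\{0,1\}\bigr\}$ (a set of $2^n$ integers; $\bigcup_{n}\Lambda_n$ is the canonical spectrum of $\mu$). For $f\in L^1(\mu)$ and $\lambda\in\Lambda_n$ put $\widehat f(\lambda)=\int f(x)e^{-2\pi i\lambda x}\,d\mu(x)$. The $n$-th partial sum of the mock Fourier series of $f$ is $$S_nf(x)=\sum_{\lambda\in\Lambda_n}\widehat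 f(\lambda)e^{2\pi i\lambda x}.$$ *)

(* Defs.v *)
From HB Require Import structures.
From mathcomp Require Import all_boot all_order all_algebra.
From mathcomp Require Import finmap.
From mathcomp Require Import complex.
From mathcomp Require Import all_classical all_reals all_analysis.

Set Implicit Arguments.
Unset Strict Implicit.
Unset Printing Implicit Defensive.

Import Order.TTheory GRing.Theory Num.Theory.
Import numFieldNormedType.Exports.

Local Open Scope classical_set_scope.
Local Open Scope ring_scope.
Local Open Scope complex_scope.

Definition mutually_independent (R : realType) (d : measure_display)
    (T : measurableType d) (P : probability T R) (xi : nat -> {RV P >-> R}) :
    Prop :=
  forall (J : {fset nat}) (A : nat -> set R),
    (forall j, measurable (A j)) ->
    P (\bigcap_(j in [set` J]) (xi j @^-1` A j)) =
      (\prod_(j <- J) P (xi j @^-1` A j))%E.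

Definition rademacher (R : realType) (d : measure_display)
    (T : measurableType d) (P : probability T R) (X : {RV P >-> R}) : Prop :=
  P (X @^-1` [set 1]) = (2^-1)%:E /\ P (X @^-1` [set -1]) = (2^-1)%:E.

(* [xi j] is the random sign attached to the power [r ^+ j.+1], so that [X] is
   almost surely the sum over j >= 1 of the j-th sign times [r ^+ j]. *)
Definition is_bernoulli_convolution (R : realType) (r : R)
    (mu : probability R R) : Prop :=
  exists (d : measure_display) (T : measurableType d) (P : probability T R)
         (xi : nat -> {RV P >-> R}) (X : {RV P >-> R}),
    [/\ forall j, rademacher (xi j),
        mutually_independent xi,
        {ae P, forall t, series (fun j => xi j t * r ^+ j.+1) @ \oo --> X t} &
        forall A : set R, measurable A -> mu A = distribution P X A].

Definition supp (R : realType) (mu : probability R R) : set R :=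
  [set x | forall U : set R, open U -> U x -> (0 < mu U)%E].

(* The norm of [R[i]] takes its values in [R[i]]; [normc] is the real-valued
   modulus. *)
Notation normc := ComplexField.Normc.normc.

Definition L1norm (R : realType) (mu : probability R R) (f : R -> R[i]) :
    \bar R :=
  (\int[mu]_x (normc (f x))%:E)%E.

(* The members of L1 are represented by functions, not by classes modulo
   almost everywhere equality. *)
Definition inL1 (R : realType) (mu : probability R R) (f : R -> R[i]) : Prop :=
  [/\ measurable_fun setT (fun x => complex.Re (f x)),
      measurable_fun setT (fun x => complex.Im (f x)) &
      (L1norm mu f < +oo)%E].

Definition cintegral (R : realType) (mu : probability R R) (f : R -> R[i]) :
    R[i] :=
  (\int[mu]_x complex.Re (f x)) +i* (\int[mu]_x complex.Im (f x)).

Definition cexpi (R : realType) (t : R) : R[i] := cos t +i* sin t.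

Definition Lambda (n : nat) : {fset nat} :=
  [fset (\sum_(j < n) c j * 4 ^ j)%N
    | c : {ffun 'I_n -> 'I_2} in {: {ffun 'I_n -> 'I_2}}]%fset.

Definition fourier_coef (R : realType) (mu : probability R R) (f : R -> R[i])
    (l : nat) : R[i] :=
  cintegral mu (fun x => f x * cexpi (- (2 * pi * l%:R * x))).

Definition partial_sum (R : realType) (mu : probability R R) (f : R -> R[i])
    (n : nat) (x : R) : R[i] :=
  \sum_(l <- Lambda n) fourier_coef mu f l * cexpi (2 * pi * l%:R * x).

Definition maximal_op (R : realType) (mu : probability R R) (f : R -> R[i])
    (x : R) : \bar R :=
  ereal_sup [set (normc (partial_sum mu f n x))%:E | n in [set n | (1 <= n)%N]].

(* Main.v *)
Require Import Defs.
From mathcomp Require Import all_boot all_order all_algebra.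
From mathcomp Require Import finmap.
From mathcomp Require Import complex.
From mathcomp Require Import all_classical all_reals all_analysis.
From mathcomp Require Import measurable_realfun.
From mathcomp Require Import ring lra.
Import Order.TTheory GRing.Theory Num.Theory.
Import numFieldNormedType.Exports.
Import HBSimple.
Local Open Scope classical_set_scope.
Local Open Scope ring_scope.
Local Open Scope complex_scope.

(** The support of the measure is the Cantor set of the sums of the [e_j 4^-j],
    [e_j = +-1]; a binary word of length [n] fixes the first [n] signs and
    singles out a cell of measure [2^-n].  The partial sum [S_n f (x)] is the
    integral of [f (y) D_n (x - y)], where
    [D_n t = \prod_(j < n) (1 + exp (2 pi i 4^j t))] has modulus
    [\prod_(j < n) 2 |cos (pi 4^j t)|].

    The kernel is controlled one sign at a time ([dirichlet_prod_le]).  If [x]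
    and [y] agree in the sign of index [j + 1], the factor of index [j] is at
    most 2.  If they differ there, [4^j (x - y)] is a half-integer plus a
    quantity of size at most 1/6, so that this factor is twice a sine, at most 1
    and proportional to the distance that remains at scale [4^j].  When [m]
    agreeing signs follow, that distance is [4^-m] times smaller and pays for
    the [m] factors 2, with [2^-m] to spare.  The resulting bound [kmaj]
    depends only on the two words of length [n], does not increase with [n]
    once the words differ ([kmaj_cons_le]), and for a fixed word of length [n]
    has sum at most [10 * 2^n] over the words of length [n] ([sum_kmaj_le]),
    because a weighted sum over the extensions of a word that differs grows by
    a factor at most 9/5 < 2 at each level ([kpot_children]).

    The weak type inequality ([weak_type_words]) then is a Calderon-Zygmund
    argument on the binary tree, where no cancellation is needed.  Stop at the
    first cells on which the mean of [|f|] exceeds [al]; they cover measure at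
    most [|f|_1 / al].  At a point outside them, the cells that are not stopped
    by level [n] contribute at most [10 al], since the kernel has mean at most
    10.  A cell stopped at level [q] contributes at level [n > q] at most what
    it did at level [q], by monotonicity of the kernel bound; this no longer
    depends on [n], and its integral over the point is at most 10 times the
    integral of [|f|] over the cell.

    For the convergence, the frequencies are orthogonal to 1
    ([fourier_coef_cst]), so that [S_n 1 = 1].  Let [g] be constant on the cells
    of some level and [x] a point of the support.  Subtracting the constant
    [g x] from [g] leaves a function vanishing on the cell of [x], and the
    factor 9/5 < 2 gives [S_n g x --> g x] geometrically
    ([partial_sum_step_rate]).  Such functions are dense in L1
    ([complex_step_dense]) and the maximal inequality extends the convergence
    to all of L1. *)

Set Implicit Arguments.
Unset Strict Implicit.
Unset Printing Implicit Defensive.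

Local Notation Re := complex.Re.
Local Notation Im := complex.Im.

(** * Sums over binary words *)

(** Words are read from the most recent letter, their head, so that the parent
    of a nonempty word in the binary tree is its tail, and its ancestors are
    its suffixes. *)
Fixpoint words (n : nat) : seq (seq bool) :=
  if n is m.+1 then
    [seq true :: w | w <- words m] ++ [seq false :: w | w <- words m]
  else [:: [::]].

Lemma mem_words n w : (w \in words n) = (size w == n).
Proof.
have inj b : injective (cons b) by move=> x y [].
elim: n w => [|n IH] [|a w] //=.
  by rewrite mem_cat; apply/negP => /orP[] /mapP[].
rewrite eqSS -IH mem_cat.
have ni b s : (b :: w \in map (cons (~~ b)) s) = false.
  by apply/mapP => -[x _ []]; case: b.
case: a.
  by rewrite (mem_map (inj _ true)) [X in _ || X](ni true) orbF.
by rewrite (mem_map (inj _ false)) [X in X || _](ni false).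
Qed.

Lemma size_words n : size (words n) = (2 ^ n)%N.
Proof. by elim: n => //= n IH; rewrite size_cat !size_map IH addnn expnS mul2n. Qed.

Lemma big_wordsS (R : nmodType) n (P : pred (seq bool)) (G : seq bool -> R) :
  \sum_(w <- words n.+1 | P w) G w =
  \sum_(w <- words n | P (true :: w)) G (true :: w)
  + \sum_(w <- words n | P (false :: w)) G (false :: w).
Proof. by rewrite /= big_cat !big_map. Qed.

Lemma eq_big_words (R : nmodType) n (P Q : pred (seq bool))
    (F G : seq bool -> R) :
  (forall w, size w = n -> P w = Q w) ->
  (forall w, size w = n -> P w -> F w = G w) ->
  \sum_(w <- words n | P w) F w = \sum_(w <- words n | Q w) G w.
Proof.
move=> PQ FG; rewrite big_seq_cond [RHS]big_seq_cond; apply: eq_big => w.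
  by rewrite mem_words; case: eqP => //= /PQ.
by rewrite mem_words => /andP[/eqP + +]; apply: FG.
Qed.

Lemma ler_sum_words (R : numDomainType) n (P : pred (seq bool))
    (F G : seq bool -> R) :
  (forall w, size w = n -> P w -> F w <= G w) ->
  \sum_(w <- words n | P w) F w <= \sum_(w <- words n | P w) G w.
Proof.
move=> FG; rewrite big_seq_cond [leRHS]big_seq_cond; apply: ler_sum => w.
by rewrite mem_words => /andP[/eqP + +]; apply: FG.
Qed.

Lemma uniq_words n : uniq (words n).
Proof.
elim: n => //= m u; rewrite cat_uniq !map_inj_uniq ?u //=; try by move=> ? ? [].
by rewrite andbT; apply/hasPn => ? /mapP[x _ ->]; apply/mapP => -[].
Qed.

(** * The majorant of the Dirichlet kernel *)

Section kernel.
Context {R : realFieldType}.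
Implicit Types (w v : seq bool).

(** [(kpair w v).1] bounds the kernel on the product of the cells of [w] and
    [v]; when the words differ, [(kpair w v).2] bounds its slope, that is the
    kernel is at most [(kpair w v).2 * (pi / 2)] times the rescaled distance
    from [x] to [y] after removing the part due to the letters already read.
    An equal letter multiplies the kernel by at most 2 and this distance by 4,
    so it halves the slope; the bound [s] then comes from the fact that the
    rescaled distance is at most 2/3 and [pi / 2 * (2 / 3) * (s / 2) <= s].  A
    different letter contributes a sine, whence the new slope.  As long as the
    words are equal the slope means nothing and is set to 0. *)
Fixpoint kpair w v : R * R :=
  match w, v with
  | a :: w', b :: v' =>
    if w' == v' then
      (if a == b then (2 ^+ (size w').+1, 0)
       else (2 ^+ size w', 2 ^+ size w'))
    else let: (k, s) := kpair w' v' in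
      if a == b then (s, s / 2) else (k, k)
  | _, _ => (1, 0)
  end.

Definition kmaj w v := (kpair w v).1.
Definition kslope w v := (kpair w v).2.
(** The pair evolves by the matrix with rows 1, 1 and 1, 1/2 when the two
    possible letters are added up; (5, 4) is a rational vector close enough to
    the dominant eigenvector for the rate 9/5, the eigenvalue being about
    1.78. *)
Definition kpot w v := 5 * kmaj w v + 4 * kslope w v.

Lemma kmaj_id w : kmaj w w = 2 ^+ size w.
Proof. by case: w => //= a w; rewrite /kmaj /= !eqxx. Qed.

Lemma kmaj_fork a b w : a != b -> kmaj (a :: w) (b :: w) = 2 ^+ size w.
Proof. by move=> /negbTE ab; rewrite /kmaj /= eqxx ab. Qed.

Lemma kslope_fork a b w : a != b -> kslope (a :: w) (b :: w) = 2 ^+ size w.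
Proof. by move=> /negbTE ab; rewrite /kslope /= eqxx ab. Qed.

Lemma kmaj_cons a b w v : w != v ->
  kmaj (a :: w) (b :: v) = if a == b then kslope w v else kmaj w v.
Proof.
move=> /negbTE wv; rewrite /kmaj /kslope /= wv; case: (kpair w v) => k s.
by case: ifP.
Qed.

Lemma kslope_cons a b w v : w != v ->
  kslope (a :: w) (b :: v) = if a == b then kslope w v / 2 else kmaj w v.
Proof.
move=> /negbTE wv; rewrite /kmaj /kslope /= wv; case: (kpair w v) => k s.
by case: ifP.
Qed.

Lemma kslope_ge0_le w v : size w = size v -> w != v ->
  0 <= kslope w v <= kmaj w v.
Proof.
elim: w v => [|a w IH] [|b v] //= [] wv.
have [->|nwv _] := eqVneq w v.
  rewrite eqseq_cons eqxx andbT => ab.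
  by rewrite kmaj_fork // kslope_fork // lexx exprn_ge0.
have /andP[A0 AK] := IH _ wv nwv.
rewrite kmaj_cons // kslope_cons //; case: eqP => _; lra.
Qed.

Lemma kmaj_ge0 w v : size w = size v -> 0 <= kmaj w v.
Proof.
move=> wv; have [->|nwv] := eqVneq w v; first by rewrite kmaj_id exprn_ge0.
by have /andP[/le_trans + /[dup]] := kslope_ge0_le wv nwv => /[apply].
Qed.

Lemma kmaj_cons_le a b w v : size w = size v -> w != v ->
  kmaj (a :: w) (b :: v) <= kmaj w v.
Proof.
move=> wv nwv; rewrite kmaj_cons //; case: ifP => // _.
by have /andP[] := kslope_ge0_le wv nwv.
Qed.

Lemma kmaj_kslopeC w v : size w = size v ->
  kmaj w v = kmaj v w /\ kslope w v = kslope v w.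
Proof.
elim: w v => [|a w IH] [|b v] //= [] wv.
have [->|nwv] := eqVneq w v.
  have [->//|ab] := eqVneq a b.
  by rewrite !kmaj_fork // ?kslope_fork // eq_sym.
rewrite !kmaj_cons // ?kslope_cons //; try by rewrite eq_sym.
by have [-> ->] := IH _ wv; rewrite (eq_sym b).
Qed.

Lemma kmaj_le_kpot w v : size w = size v -> w != v -> kmaj w v <= kpot w v.
Proof.
move=> wv nwv; have := kslope_ge0_le wv nwv; have := kmaj_ge0 wv.
rewrite /kpot; lra.
Qed.

(** The rate 9/5 is smaller than 2, the number of children: on average the
    kernel decays geometrically away from its diagonal. *)
Lemma kpot_children a w v : size w = size v -> w != v ->
  kpot (a :: w) (true :: v) + kpot (a :: w) (false :: v) <= 9 / 5 * kpot w v.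
Proof.
move=> wv nwv; have := kslope_ge0_le wv nwv; rewrite /kpot.
by case: a; rewrite !kmaj_cons // !kslope_cons //=; lra.
Qed.

(** A word differing from [a :: w] either forks at its head, which contributes
    [9 * 2^n], or extends a word differing from [w].  The constant 45 is the
    fixed point of [K |-> (9 / 5 * K + 9) / 2]. *)
Lemma sum_kpot_le n w : size w = n ->
  \sum_(v <- words n | v != w) kpot w v <= 45 * 2 ^+ n.
Proof.
elim: n w => [|n IH] [|a w] //= => [_|[] wn].
  by rewrite big_cons eqxx big_nil expr0 mulr1 ler0n.
rewrite big_wordsS.
have split b : \sum_(v <- words n | b :: v != a :: w) kpot (a :: w) (b :: v)
    = \sum_(v <- words n | v != w) kpot (a :: w) (b :: v)
      + (if b == a then 0 else 9 * 2 ^+ n).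
  rewrite (bigID (fun v => v != w)) /=; congr (_ + _).
    apply: eq_bigl => v; rewrite eqseq_cons.
    by case: (v == w); rewrite ?andbF ?andbT.
  have [->|ba] := eqVneq b a.
    by rewrite big1 // => v; rewrite eqseq_cons eqxx negbK; case: (v == w).
  rewrite (eq_bigl (pred1 w)); last first.
    by move=> v; rewrite eqseq_cons negb_and ba negbK.
  rewrite -big_filter filter_pred1_uniq ?uniq_words ?mem_words ?wn ?eqxx //.
  rewrite big_seq1 /kpot kmaj_fork 1?eq_sym //.
  by rewrite kslope_fork 1?eq_sym // wn; ring.
rewrite !split.
have le : \sum_(v <- words n | v != w) kpot (a :: w) (true :: v) +
   \sum_(v <- words n | v != w) kpot (a :: w) (false :: v)
   <= 9 / 5 * \sum_(v <- words n | v != w) kpot w v.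
  rewrite -big_split /= mulr_sumr; apply: ler_sum_words => v vn vw.
  by apply: kpot_children; rewrite ?wn ?vn // eq_sym.
have := IH _ wn; rewrite exprS => IHw.
have p0 : 0 <= 2 ^+ n :> R by rewrite exprn_ge0.
case: a {split} le => /= le; lra.
Qed.

Lemma sum_kmaj_le n w : size w = n ->
  \sum_(v <- words n) kmaj w v <= 10 * 2 ^+ n.
Proof.
move=> wn; rewrite (bigD1_seq w) ?uniq_words ?mem_words ?wn ?eqxx //= kmaj_id wn.
have := sum_kpot_le wn.
have le : 5 * (\sum_(v <- words n | v != w) kmaj w v)
    <= \sum_(v <- words n | v != w) kpot w v.
  rewrite mulr_sumr; apply: ler_sum_words => v vn vw.
  have := @kslope_ge0_le w v; rewrite wn vn eq_sym vw => /(_ erefl isT).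
  by rewrite /kpot; lra.
lra.
Qed.

(** [drop L] yields the ancestor at level [q]: only the words that already
    differ from [w] at that level are counted. *)
Lemma sum_kpot_drop q L w : size w = (L + q)%N ->
  \sum_(v <- words (L + q) | drop L v != drop L w) kpot w v <=
  (9 / 5) ^+ L * (45 * 2 ^+ q).
Proof.
elim: L w => [|L IH] w.
  rewrite !drop0 => wn; rewrite mul1r.
  by under eq_bigl do rewrite drop0; apply: sum_kpot_le.
case: w => // a w [] wn; rewrite addSn big_wordsS /= -big_split /=.
rewrite exprS -mulrA; apply: le_trans (ler_wpM2l _ (IH _ wn)); last by lra.
rewrite mulr_sumr; apply: ler_sum_words => v vn vw.
apply: kpot_children; first by rewrite wn vn.
by apply: contraNneq vw => ->.
Qed.

End kernel.

(** * The weak type inequality on the binary tree *)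

Section weak_type.
Context {R : realFieldType}.
Variables (F : seq bool -> R) (al : R).
Hypothesis F_ge0 : forall w, 0 <= F w.
Hypothesis F_cons : forall w, F w = F (true :: w) + F (false :: w).
Hypothesis al_gt0 : 0 < al.
Implicit Types (w v : seq bool).

Definition majorant w := \sum_(v <- words (size w)) kmaj w v * F v.

(** Cells of level [n] have measure [2^-n], so hot words are those over which
    the mean of [F] exceeds [al]; the new words are the stopping cells of the
    decomposition and the bad ones their descendants. *)
Let hot v := al < 2 ^+ size v * F v.
Let bad := fix bad v := hot v || (if v is _ :: v' then bad v' else false).
Let new v := if v is _ :: v' then hot v && ~~ bad v' else hot v.
Let New w := \sum_(v <- words (size w) | new v) kmaj w v * F v.
(** The contribution of all the cells stopped along the way to [w], each
    evaluated at the level where it was stopped. *)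
Let Bsum := fix B w := New w + (if w is _ :: w' then B w' else 0).

Let New_ge0 w : 0 <= New w.
Proof.
rewrite /New big_seq_cond; apply: sumr_ge0 => v; rewrite mem_words => /andP[/eqP vw _].
by rewrite mulr_ge0 ?kmaj_ge0 ?vw.
Qed.

Let bad_cons a v : bad (a :: v) = hot (a :: v) || bad v. Proof. by []. Qed.

(** The bad words below [b :: v] with [v] bad descend from words differing from
    the good word [w], where the kernel bound does not increase: they weigh no
    more than their parents, and only the new words remain to be added. *)
Let sum_bad_le w : ~~ bad w ->
  \sum_(v <- words (size w) | bad v) kmaj w v * F v <= Bsum w.
Proof.
elim: w => [/=|a w IH].
  by rewrite orbF => /negbTE h; rewrite big_cons big_nil /= h /= addr0 New_ge0.
rewrite [size _]/= bad_cons negb_or => /andP[_ gw].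
have -> : Bsum (a :: w) = New (a :: w) + Bsum w by [].
rewrite (bigID new) /=; apply: lerD.
  rewrite /New /=; rewrite le_eqVlt; apply/orP; left; apply/eqP.
  apply: eq_bigl => -[|b v] //=; first by rewrite orbF andbb.
  by case: (hot _); case: (bad v).
apply: le_trans (IH gw); rewrite big_wordsS /=.
have E b : \sum_(v <- words (size w) |
      (hot (b :: v) || bad v) && ~~ (hot (b :: v) && ~~ bad v))
      kmaj (a :: w) (b :: v) * F (b :: v)
    = \sum_(v <- words (size w) | bad v) kmaj (a :: w) (b :: v) * F (b :: v).
  by apply: eq_bigl => v; case: (hot _); case: (bad v).
rewrite !E -big_split /=; apply: ler_sum_words => v vw bv.
have wv : w != v by apply: contraNneq gw => ->.
rewrite [in leRHS](F_cons v) mulrDr.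
by apply: lerD; apply: ler_wpM2r => //; apply: kmaj_cons_le.
Qed.

(** On a good word [F] is at most [al * 2^-n]: with the bound on the sum of the
    kernel this gives [10 * al]. *)
Let majorant_le w : ~~ bad w -> majorant w <= 10 * al + Bsum w.
Proof.
move=> gw; rewrite /majorant (bigID bad) /= addrC; apply: lerD; last exact: sum_bad_le.
have p0 : 0 < 2 ^+ size w :> R by rewrite exprn_gt0.
apply: (@le_trans _ _ (\sum_(v <- words (size w) | ~~ bad v)
    kmaj w v * (al / 2 ^+ size w))).
  apply: ler_sum_words => v vw; case: v vw => [|b v] vw.
    rewrite /= orbF -leNgt /= -vw /= => h.
    by apply: ler_wpM2l; [apply: kmaj_ge0|rewrite expr0; lra].
  rewrite bad_cons negb_or => /andP[h _]; apply: ler_wpM2l; first by apply: kmaj_ge0.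
  by rewrite ler_pdivlMr // mulrC -vw leNgt.
rewrite -mulr_suml; apply: (@le_trans _ _ (10 * 2 ^+ size w * (al / 2 ^+ size w))).
  apply: ler_wpM2r; first by rewrite divr_ge0 // ltW.
  apply: le_trans (sum_kmaj_le erefl).
  rewrite [leRHS](bigID (fun v => ~~ bad v)) /= lerDl.
  rewrite big_seq_cond; apply: sumr_ge0 => v; rewrite mem_words => /andP[/eqP vw _].
  by apply: kmaj_ge0.
by rewrite -mulrA (mulrC (2 ^+ _)) divfK // gt_eqF.
Qed.

Let beta n := \sum_(v <- words n | bad v) F v.

Let sum_F n : \sum_(v <- words n) F v = F [::].
Proof.
elim: n => [|n IH]; first by rewrite /= big_cons big_nil addr0.
by rewrite big_wordsS -big_split /= -[RHS]IH; apply: eq_bigr => v _.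
Qed.

Let beta_le n : beta n <= F [::].
Proof.
rewrite -(sum_F n) [leRHS](bigID bad) /= lerDl; exact: sumr_ge0.
Qed.

Let betaS n : beta n.+1 = beta n + \sum_(v <- words n.+1 | new v) F v.
Proof.
rewrite /beta (bigID new) addrC; congr (_ + _).
  by apply: eq_big_words => -[|b v] //= _; case: (hot _); case: (bad v).
rewrite big_wordsS.
transitivity (\sum_(v <- words n | bad v) F (true :: v)
    + \sum_(v <- words n | bad v) F (false :: v)).
  by congr (_ + _); apply: eq_bigl => v /=; case: (hot _); case: (bad v).
by rewrite -big_split; apply: eq_bigr => v _; rewrite [in RHS]F_cons.
Qed.

(** Exchanging the two sums, each new word is weighed by the sum of the kernel
    in its other argument, which symmetry bounds in the same way. *)
Let sum_Bsum n : \sum_(w <- words n) Bsum w <= 10 * 2 ^+ n * beta n.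
Proof.
have sumNew m : \sum_(w <- words m) New w
    <= 10 * 2 ^+ m * \sum_(v <- words m | new v) F v.
  rewrite (@eq_big_words _ _ _ xpredT _
    (fun w => \sum_(v <- words m | new v) kmaj w v * F v)) //; last first.
    by move=> w; rewrite /New => ->.
  rewrite exchange_big /= mulr_sumr; apply: ler_sum_words => v vm _.
  rewrite -mulr_suml; apply: ler_wpM2r => //.
  rewrite (@eq_big_words _ _ _ xpredT _ (kmaj v)) ?sum_kmaj_le // => w wm _.
  by case: (@kmaj_kslopeC R w v); rewrite ?wm.
elim: n => [|n IH].
  have /= := sumNew 0; rewrite /= !big_cons !big_nil /= addr0.
  by rewrite /beta big_cons big_nil /= orbF !addr0.
have -> : \sum_(w <- words n.+1) Bsum w
    = \sum_(w <- words n.+1) New w + 2 * \sum_(w <- words n) Bsum w.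
  rewrite !big_wordsS /= !big_split /=; ring.
rewrite betaS mulrDr addrC; apply: lerD; last exact: sumNew.
have := IH; rewrite exprS; lra.
Qed.

Let count_bad n : al * \sum_(w <- words n | bad w) 1 <= 2 ^+ n * beta n.
Proof.
have countNew m : al * \sum_(w <- words m | new w) 1
    <= 2 ^+ m * \sum_(v <- words m | new v) F v.
  rewrite !mulr_sumr; apply: ler_sum_words => w wm nw.
  suff : hot w by rewrite /hot wm mulr1 => /ltW.
  by case: w nw {wm} => //= b v /andP[].
elim: n => [|n IH].
  have := countNew 0; rewrite /= !big_cons !big_nil /=.
  by rewrite /beta big_cons big_nil /= orbF.
have -> : \sum_(w <- words n.+1 | bad w) 1
    = \sum_(w <- words n.+1 | new w) 1 + 2 * \sum_(w <- words n | bad w) 1 :> R.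
  rewrite (bigID new); congr (_ + _).
    by apply: eq_big_words => -[|b v] //= _; case: (hot _); case: (bad v).
  rewrite big_wordsS mulr_natl mulr2n; congr (_ + _);
    by apply: eq_bigl => v /=; case: (hot _); case: (bad v).
rewrite betaS !mulrDr addrC; apply: lerD; last exact: countNew.
have := IH; rewrite exprS; lra.
Qed.

(** A word in [B] is either bad or has [al <= Bsum w].  The bad ones number at
    most [2^N F [::] / al], and the total of [Bsum] is at most
    [10 * 2^N * F [::]], whence the constant 11. *)
Lemma weak_type_words N (B : pred (seq bool)) :
  (forall w, size w = N -> B w ->
     exists2 n, (n <= N)%N & 11 * al < majorant (drop (N - n) w)) ->
  al * \sum_(w <- words N | B w) 1 <= 11 * 2 ^+ N * F [::].
Proof.
move=> HB.
have suffix w k : ~~ bad w ->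
    ~~ bad (drop k w) /\ Bsum (drop k w) <= Bsum w.
  elim: w k => [|a w IH] [|k] //; rewrite bad_cons negb_or => /andP[_ gw].
  have [? h] := IH k gw; split => //=; apply: le_trans h _.
  by rewrite lerDr; exact: New_ge0.
have Bsum_ge0 w : 0 <= Bsum w.
  by elim: w => [|a w IH] /=; rewrite addr_ge0 // New_ge0.
have sub w : size w = N -> B w -> ~~ bad w -> al <= Bsum w.
  move=> wN /(HB _ wN)[n nN maj] gw.
  have [gd le] := suffix _ (N - n)%N gw.
  have := majorant_le gd; lra.
have h1 : al * \sum_(w <- words N | B w) 1 <=
    al * \sum_(w <- words N | bad w) 1 + \sum_(w <- words N) Bsum w.
  rewrite (bigID bad) /= mulrDr; apply: lerD.
    apply: ler_wpM2l; first exact: ltW.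
    rewrite big_mkcond [leRHS]big_mkcond.
    by apply: ler_sum_words => w _ _; case: (B w); case: (bad w).
  rewrite mulr_sumr big_mkcond; apply: ler_sum_words => w wN _.
  by case: ifP => // /andP[Bw gw]; rewrite mulr1; apply: sub.
have p0 : 0 <= 2 ^+ N :> R by rewrite exprn_ge0.
have h2 := ler_wpM2l p0 (beta_le N).
have := count_bad N; have := sum_Bsum N; lra.
Qed.

End weak_type.

(** * Trigonometric estimates *)

Section trig.
Context {R : realType}.
Implicit Types x y z : R.

Lemma lipschitz_sin x y : `|sin x - sin y| <= `|x - y|.
Proof.
wlog xy : x y / x <= y.
  move=> H; have [xy|/ltW xy] := leP x y; first exact: H.
  by rewrite (distrC (sin x)) (distrC x) H.
have [] := @MVT_segment R sin cos x y xy.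
  by apply: continuous_subspaceT => t; exact: continuous_sin.
move=> c _ E; rewrite (distrC (sin x)) E normrM (distrC y).
by rewrite ler_piMl // cos_max.
Qed.

Lemma normr_sin_le x : `|sin x| <= `|x|.
Proof. by have := lipschitz_sin x 0; rewrite sin0 !subr0. Qed.

Lemma lipschitz_cos x y : `|cos x - cos y| <= `|x - y|.
Proof.
have := lipschitz_sin (x + pi / 2) (y + pi / 2); rewrite !sinDpihalf.
by rewrite (_ : x + _ - _ = x - y) //; ring.
Qed.

Lemma sin_pi6 : sin (pi / 6) = 1 / 2 :> R.
Proof.
set a := pi / 6; have pi0 : 0 < pi :> R := pi_gt0 R.
have s0 : 0 < sin a by apply: sin_gt0_pihalf; rewrite /a; lra.
have : sin (a *+ 2 + a) = 1.
  by rewrite (_ : _ + _ = pi / 2) ?sin_pihalf // /a; field.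
rewrite sinD sin_mulr2n cos_mulr2n.
have := cos2Dsin2 a; move: (sin a) (cos a) s0 => s c s0 h1 h2.
(* the triple angle formula gives [3 s - 4 s^3 = 1] *)
have h3 : (s + 1) * (2 * s - 1) ^+ 2 = 0.
  have c2 : c ^+ 2 = 1 - s ^+ 2 by rewrite -[1]h1; ring.
  have : c ^+ 2 * s *+ 2 + (2 * c ^+ 2 - 1) * s = 1 by rewrite -[RHS]h2; ring.
  rewrite c2 => h; transitivity
    (1 - ((1 - s ^+ 2) * s *+ 2 + (2 * (1 - s ^+ 2) - 1) * s)); first by ring.
  by rewrite h subrr.
have /eqP := h3; rewrite mulf_eq0 expf_eq0 /= => /orP[]/eqP e; lra.
Qed.

Lemma normr_sin_le_half x : `|x| <= pi / 6 -> `|sin x| <= 1 / 2.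
Proof.
have pi0 : 0 < pi :> R := pi_gt0 R.
have mono y z : - (pi / 2) <= y <= pi / 2 -> - (pi / 2) <= z <= pi / 2 ->
    y <= z -> sin y <= sin z.
  by move=> hy hz; rewrite !leNgt ltr_sin ?in_itv.
rewrite ler_norml => /andP[h1 h2]; rewrite ler_norml; apply/andP; split.
  by rewrite -sin_pi6 -sinN; apply: mono; lra.
by rewrite -sin_pi6; apply: mono; lra.
Qed.

Lemma normr_cosDpiMz x (k : int) : `|cos (x + pi * k%:~R)| = `|cos x|.
Proof.
have nat y n : `|cos (y + pi * n%:R)| = `|cos y|.
  rewrite mulr_natr (alternatingn (@cosDpi R)) normrM normrX normrN normr1.
  by rewrite expr1n mul1r.
case: k => n; first by rewrite nat.
rewrite NegzE mulrNz -[in RHS](subrK (pi * n.+1%:R) x) mulrN.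
by rewrite nat.
Qed.

End trig.

(** * Cells of the support *)

Section cells.
Context {R : realType}.
Implicit Types (w v : seq bool) (x y : R).

Definition digit (a : bool) : R := if a then 1 else -1.

Fixpoint midpoint w : R :=
  if w is a :: w' then midpoint w' + digit a * 4^-1 ^+ size w else 0.

(** The radius is the sum of the remaining powers of 1/4, so that every point
    of the support whose first signs are given by [w] lies in [cell w]. *)
Definition cell w : set R :=
  [set x | `|x - midpoint w| <= 4^-1 ^+ size w / 3].

(** Reading the signs off by comparison with the midpoints makes the address of
    every real number defined, and measurable as a function of it, although it
    is meaningful only for the points lying in [cell (address n x)]. *)
Fixpoint address (n : nat) (x : R) : seq bool :=
  if n is m.+1 then (midpoint (address m x) < x) :: address m x else [::].

Lemma size_address n x : size (address n x) = n.
Proof. by elim: n => //= n ->. Qed.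

Lemma drop_address k n x : drop k (address (k + n) x) = address n x.
Proof. by elim: k => [|k IH]; rewrite ?drop0. Qed.

Lemma exp4V_gt0 n : 0 < 4^-1 ^+ n :> R.
Proof. by rewrite exprn_gt0 ?invr_gt0. Qed.

Lemma cell_sub a w : cell (a :: w) `<=` cell w.
Proof.
move=> x; rewrite /cell /= exprS; have := exp4V_gt0 (size w).
move: (_ ^+ _) => q q0; rewrite !ler_norml /digit.
by case: a => h; lra.
Qed.

Lemma cell_side a w x : cell (a :: w) x -> (midpoint w < x) = a.
Proof.
rewrite /cell /= exprS; have := exp4V_gt0 (size w).
move: (_ ^+ _) => q q0; rewrite !ler_norml /digit.
case: a => h; first lra.
by apply/negP => ?; lra.
Qed.

Lemma address_cell n w x : size w = n -> cell w x -> address n x = w.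
Proof.
elim: n w => [|n IH] [|a w] //= [] wn xw.
have E : address n x = w by apply: IH wn _; exact: cell_sub xw.
by rewrite E (cell_side xw).
Qed.

(** Midpoints of level [n] differ by even multiples of [4^-n]: the letters
    already read do not affect [|cos (pi 4^n t)|]. *)
Lemma midpoint_diff w v : size w = size v ->
  exists k : int, 4 ^+ size w * (midpoint w - midpoint v) = 2 * k%:~R.
Proof.
elim: w v => [|a w IH] [|b v] //=; first by exists 0; rewrite subrr !mulr0.
move=> [] wv; have [k E] := IH _ wv.
pose e (c : bool) : int := if c then 1 else 0.
exists (4 * k + (e a - e b)).
have Ea : digit a - digit b = 2 * (e a - e b)%:~R.
  by rewrite /digit /e; case: a; case: b; rewrite /= ?subrr ?subr0 ?sub0r; lra.
have -> : 2 * (4 * k + (e a - e b))%:~R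
    = 4 * (2 * k%:~R) + (digit a - digit b) :> R.
  by rewrite Ea [in LHS]intrD [in LHS]intrM; ring.
rewrite -E -wv.
have p : 4 ^+ (size w).+1 * 4^-1 ^+ (size w).+1 = 1 :> R.
  by rewrite -exprMn mulfV ?expr1n ?pnatr_eq0.
transitivity (4 * (4 ^+ size w * (midpoint w - midpoint v)) +
  (digit a - digit b) * (4 ^+ (size w).+1 * 4^-1 ^+ (size w).+1)).
  by rewrite [4 ^+ (size w).+1]exprS; ring.
by rewrite p mulr1.
Qed.

Definition dirichlet_prod n (t : R) :=
  \prod_(j < n) `|2 * cos (pi * (4 ^+ j * t))|.

(** The distance from [x] to [y] at scale [4^n] once the letters read so far
    have been removed; this is the distance in which the slope [kslope] is
    expressed. *)
Definition offset w v x y := 4 ^+ size w * `|(x - midpoint w) - (y - midpoint v)|.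

Lemma offset_le w v x y : size w = size v -> cell w x -> cell v y ->
  offset w v x y <= 2 / 3.
Proof.
move=> wv; rewrite /cell /offset /= -wv => xw yv.
have p : 4 ^+ (size w) * 4^-1 ^+ (size w) = 1 :> R.
  by rewrite -exprMn mulfV ?expr1n ?pnatr_eq0.
apply: (@le_trans _ _ (4 ^+ size w * (2 / 3 * 4^-1 ^+ size w))); last first.
  by rewrite mulrCA p mulr1.
apply: ler_wpM2l; first by rewrite exprn_ge0.
apply: le_trans (ler_normB _ _) _; lra.
Qed.

(** When the next letters differ, the midpoints shift the argument of the cosine
    by a right angle and turn it into the sine of [pi / 4 * offset], at most
    [pi / 6]. *)
Lemma dirichlet_step a b w v x y : size w = size v ->
  `|2 * cos (pi * (4 ^+ size w * (x - y)))| <= 2 /\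
  (a != b -> cell (a :: w) x -> cell (b :: v) y ->
   `|2 * cos (pi * (4 ^+ size w * (x - y)))| <= 1 /\
   `|2 * cos (pi * (4 ^+ size w * (x - y)))|
     <= pi / 2 * offset (a :: w) (b :: v) x y).
Proof.
move=> wv; set c := `|_ * cos _|; have pi0 : 0 < pi :> R := pi_gt0 R.
have c2 : c = 2 * `|cos (pi * (4 ^+ size w * (x - y)))|.
  by rewrite /c normrM ger0_norm.
split; first by rewrite c2; have := cos_max (pi * (4 ^+ size w * (x - y))); lra.
move=> ab xw yv.
set o := offset _ _ _ _.
have ole : o <= 2 / 3 by apply: offset_le => //=; rewrite wv.
set z := pi / 4 *
  (4 ^+ (size w).+1 * ((x - midpoint (a :: w)) - (y - midpoint (b :: v)))).
have zo : `|z| = pi / 4 * o.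
  rewrite /z normrM ger0_norm; last by lra.
  by rewrite normrM ger0_norm ?exprn_ge0.
suff cE : c = 2 * `|sin z|.
  rewrite cE; split.
    have := @normr_sin_le_half R z; rewrite zo => h.
    have /h : pi / 4 * o <= pi / 6 by nra.
    by lra.
  by have := normr_sin_le z; rewrite zo; lra.
have [k kE] := midpoint_diff wv.
have p : 4 ^+ (size w).+1 * 4^-1 ^+ (size w).+1 = 1 :> R.
  by rewrite -exprMn mulfV ?expr1n ?pnatr_eq0.
have E : pi * (4 ^+ size w * (x - y)) =
   (z + (digit a - digit b) * (pi / 4)) + pi * (2 * k)%:~R.
  rewrite intrM -kE /z /= -wv; move: p; rewrite [4 ^+ _.+1]exprS.
  move: (4^-1 ^+ _) (4 ^+ size w) => q r p.
  rewrite -[_ * (pi / 4)]mulr1 -[X in _ * (pi / 4) * X]p.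
  by field.
rewrite c2 E normr_cosDpiMz; congr (_ * _).
case: a b ab {xw yv o ole zo E kE} @z => -[] // _ z; rewrite /digit.
  by rewrite (_ : z + _ = z + pi / 2) ?cosDpihalf ?normrN //; field.
by rewrite (_ : z + _ = z - pi / 2) ?cosBpihalf //; field.
Qed.

Lemma offset_same a w v x y : size w = size v ->
  offset w v x y = offset (a :: w) (a :: v) x y / 4.
Proof.
move=> wv; rewrite /offset /= -wv exprS.
rewrite (_ : x - (midpoint w + _) - _ = x - midpoint w - (y - midpoint v)).
  by field.
by ring.
Qed.

Lemma dirichlet_prod_ge0 n t : 0 <= dirichlet_prod n t.
Proof. by apply: prodr_ge0. Qed.

(** The two bounds have to be carried together: the slope bound at one level
    produces the size bound after a repeated letter, and the size bound
    produces the slope bound after a differing one. *)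
Lemma dirichlet_prod_le w v x y : size w = size v -> cell w x -> cell v y ->
  dirichlet_prod (size w) (x - y) <= kmaj w v /\
  (w != v -> dirichlet_prod (size w) (x - y)
     <= kslope w v * (pi / 2 * offset w v x y)).
Proof.
have pi0 : 0 < pi :> R := pi_gt0 R.
elim: w v => [|a w IH] [|b v] //=.
  by move=> _ _ _; rewrite /dirichlet_prod big_ord0.
move=> [] wv xw yv.
have [Kle Ale] := IH _ wv (cell_sub xw) (cell_sub yv).
have P0 := dirichlet_prod_ge0 (size w) (x - y).
rewrite /dirichlet_prod big_ord_recr /= -/(dirichlet_prod _ _).
have [c2 cab] := dirichlet_step a b x y wv.
move: (`|2 * _|) (normr_ge0 (2 * cos (pi * (4 ^+ size w * (x - y))))) c2 cab.
move=> c c0 c2 cab.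
have /offset_le/(_ xw yv) : size (a :: w) = size (b :: v) by rewrite /= wv.
have o0 : 0 <= offset (a :: w) (b :: v) x y.
  by rewrite mulr_ge0 ?exprn_ge0.
have [ab|ab] := eqVneq a b.
  rewrite ab in xw o0 *; have := offset_same b x y wv.
  set o := offset (b :: w) _ _ _; move=> oE ole.
  have [wvE|nwv] := eqVneq w v.
    subst v; split; last by rewrite eqxx.
    rewrite kmaj_id /= exprS; move: Kle; rewrite kmaj_id; nra.
  rewrite kmaj_cons // kslope_cons // eqxx eqseq_cons eqxx /= nwv.
  have /andP[A0 _] := @kslope_ge0_le R _ _ wv nwv.
  have := Ale nwv; rewrite oE => h.
  have h2 : dirichlet_prod (size w) (x - y) * c <= kslope w v / 2 * (pi / 2 * o).
    nra.
  split => //; apply: le_trans h2 _.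
  have pi4 : pi <= 4 :> R by have := pihalf_lt2 R; lra.
  have : pi / 2 * o <= 2 by nra.
  nra.
move=> _; have [c1 co] := cab ab xw yv.
have K0 := @kmaj_ge0 R _ _ wv.
have [KE AE] : kmaj (a :: w) (b :: v) = kmaj w v :> R /\
    kslope (a :: w) (b :: v) = kmaj w v :> R.
  have [wvE|nwv] := eqVneq w v.
    by subst v; rewrite kmaj_fork // kslope_fork // kmaj_id.
  by rewrite kmaj_cons // kslope_cons // (negbTE ab).
rewrite KE AE; split => [|_]; first nra.
by apply: ler_pM.
Qed.

End cells.

(** * The measure of a cell *)

Section bernoulli.
Context {R : realType}.
Implicit Types (w v : seq bool) (x y : R).

Lemma measurable_cell w : measurable (@cell R w).
Proof.
rewrite (_ : cell w = `[midpoint w - 4^-1 ^+ size w / 3,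
    midpoint w + 4^-1 ^+ size w / 3]%classic); first exact: measurable_itv.
by apply/seteqP; split => x; rewrite /cell /= in_itv /= ler_distl.
Qed.

Lemma cell_children_disjoint w :
  cell (true :: w) `&` cell (false :: w) = @set0 R.
Proof. by apply/seteqP; split => // x [/cell_side h /cell_side]; rewrite h. Qed.

Lemma series_midpoint (s : nat -> R) w :
  (forall j, (j < size w)%N -> s j = digit (nth false w (size w - j.+1))) ->
  series (fun j => s j * 4^-1 ^+ j.+1) (size w) = midpoint w.
Proof.
elim: w => [|a w IH] sw; first by rewrite /series /= big_geq.
rewrite seriesSr /= IH => [|j jw].
  by rewrite sw //= subnn.
by rewrite sw ?ltnS ?(ltnW jw) //= subSS -subnSK.
Qed.

Lemma series_tail (s : nat -> R) n k : (forall j, `|s j| = 1) ->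
  `|series (fun j => s j * 4^-1 ^+ j.+1) (n + k)
    - series (fun j => s j * 4^-1 ^+ j.+1) n| <= 4^-1 ^+ n / 3.
Proof.
move=> s1; set S := series _.
suff : `|S (n + k)%N - S n| <= (4^-1 ^+ n - 4^-1 ^+ (n + k)) / 3.
  by have := exp4V_gt0 (R := R) (n + k); lra.
elim: k => [|k IH]; first by rewrite addn0 !subrr normr0 mul0r.
rewrite addnS /S seriesSr -/S addrAC; apply: le_trans (ler_normD _ _) _.
rewrite normrM s1 mul1r ger0_norm ?(ltW (exp4V_gt0 _)) // exprS.
have := exp4V_gt0 (R := R) (n + k); lra.
Qed.

Lemma limit_in_cell (s : nat -> R) l w : (forall j, `|s j| = 1) ->
  (forall j, (j < size w)%N -> s j = digit (nth false w (size w - j.+1))) ->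
  series (fun j => s j * 4^-1 ^+ j.+1) @ \oo --> l -> cell w l.
Proof.
move=> s1 sw cv; rewrite /cell /= -(series_midpoint sw).
set c := series _ _.
have cv' : (fun k => `|series (fun j => s j * 4^-1 ^+ j.+1) (k + size w)%N - c|)
    @ \oo --> `|l - c|.
  apply: cvg_norm; apply: cvgB; last exact: cvg_cst.
  by move: cv; rewrite -(cvg_shiftn (size w)).
rewrite -(cvg_lim (@Rhausdorff R) cv').
apply: limr_le; first by apply/cvg_ex; eexists; exact: cv'.
by near=> k; rewrite addnC; apply: series_tail.
Unshelve. all: by end_near. Qed.

Context (mu : probability R R).
Hypothesis hmu : is_bernoulli_convolution (4^-1) mu.

(** By independence the first [n] signs agree with [w] with probability [2^-n],
    and then the random series converges inside [cell w]. *)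
Lemma mu_cell_ge w : (((2^-1) ^+ size w)%:E <= mu (cell w))%E.
Proof.
case: hmu => d [T [P [xi [X [rad ind cv muE]]]]].
rewrite muE; last exact: measurable_cell.
rewrite /distribution /pushforward /=.
pose J : {fset nat} := seq_fset tt (iota 0 (size w)).
pose A (j : nat) : set R := [set digit (nth false w (size w - j.+1))].
have mA j : measurable (A j) by exact: measurable_set1.
pose B := \bigcap_(j in [set` J]) (xi j @^-1` A j).
have PB : P B = ((2^-1) ^+ size w)%:E.
  rewrite /B ind // (eq_bigr (fun=> (2^-1)%:E)); last first.
    by move=> j _; rewrite /A; have [] := rad j; case: nth.
  have -> (r : seq nat) : (\prod_(j <- r) (2^-1 : R)%:E = (2^-1 ^+ size r)%:E)%E.
    by elim: r => [|j r IH]; rewrite ?big_nil // big_cons IH -EFinM exprS.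
  by rewrite size_seq_fset undup_id ?iota_uniq // size_iota.
rewrite -PB.
have mB : measurable B.
  apply: fin_bigcap_measurable; first exact: finite_fset.
  by move=> j _; rewrite -[_ @^-1` _]setTI; exact: measurable_funP.
have mXw : measurable (X @^-1` cell w).
  rewrite -[_ @^-1` _]setTI; apply: measurable_funP => //; exact: measurable_cell.
have signs : {ae P, forall t, forall j, `|xi j t| = 1}.
  apply/ae_foralln => j.
  have mp a : measurable (xi j @^-1` [set (a : R)]).
    by rewrite -[_ @^-1` _]setTI; apply: measurable_funP.
  have mU := measurableU _ _ (mp 1) (mp (-1)).
  exists (~` (xi j @^-1` [set 1] `|` xi j @^-1` [set -1])); split.
  - exact: measurableC.
  - apply: etrans (probability_setC P mU) _.
    suff -> : P (xi j @^-1` [set 1] `|` xi j @^-1` [set -1]) = 1%E.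
      by rewrite subee.
    apply: etrans (measureU _ (mp 1) (mp (-1)) _) _.
      apply/seteqP; split => // t [/= -> /eqP].
      by rewrite -subr_eq0 opprK -mulr2n pnatr_eq0.
    apply: etrans (congr2 adde (rad j).1 (rad j).2) _.
    by congr EFin; rewrite -[2^-1]mul1r -splitr.
  - by move=> t /= nt [|] e; apply: nt; rewrite e ?normrN normr1.
have [N [mN PN sN]] : {ae P, forall t, B t -> cell w (X t)}.
  apply: filterS2 signs cv => t s1 cvt Bt; apply: limit_in_cell s1 _ cvt.
  by move=> j jw; have := Bt j; rewrite /= seq_fsetE mem_iota => /(_ jw).
apply: (@le_trans _ _ (P (X @^-1` cell w `|` N))).
  apply: le_measure; rewrite ?inE //; first exact: measurableU.
  move=> t Bt; have [|h] := pselect (cell w (X t)); first by left.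
  by right; apply: sN => /= /(_ Bt).
apply: le_trans (measureU2 _ _ _) _ => //.
by rewrite [X in (_ + X <= _)%E](_ : _ = 0%E) ?adde0 //.
Qed.

(** The two children of a cell are disjoint, and their measures, bounded below
    by [2^-(n+1)], add up to at most [2^-n]. *)
Lemma mu_cell w : mu (cell w) = ((2^-1) ^+ size w)%:E.
Proof.
have mc := measurable_cell.
elim: w => [|a w IH].
  by apply/eqP; rewrite eq_le mu_cell_ge andbT; exact: probability_le1.
have disj := cell_children_disjoint w.
have : (mu (cell (true :: w)) + mu (cell (false :: w)) <= (2^-1 ^+ size w)%:E)%E.
  rewrite -measureU // -IH; apply: le_measure; rewrite ?inE //.
    exact: measurableU.
  by move=> x []; exact: cell_sub.
have := mu_cell_ge (true :: w); have := mu_cell_ge (false :: w).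
have fin b : mu (cell (b :: w)) \is a fin_num by exact: fin_num_measure.
have := fin true; have := fin false.
case: a => /fineK <- /fineK <-; rewrite -EFinD !lee_fin /= exprS => *; congr EFin; lra.
Qed.

Lemma mu_cell_diff w :
  mu (cell w `\` (cell (true :: w) `|` cell (false :: w))) = 0%E.
Proof.
have mc := measurable_cell.
have mU : measurable (cell (true :: w) `|` cell (false :: w) : set R).
  exact: measurableU.
have disj := cell_children_disjoint w.
rewrite measureD // ?(le_lt_trans (probability_le1 _ _)) ?ltry //.
rewrite setIUr !setIidr; try exact: cell_sub.
rewrite measureU //.
transitivity ((2^-1 ^+ size w)%:E
    - ((2^-1 ^+ (size w).+1)%:E + (2^-1 ^+ (size w).+1)%:E) : \bar R)%E.
  by congr (_ - (_ + _))%E; exact: mu_cell.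
by congr EFin; rewrite exprS; lra.
Qed.

Lemma cell_cover_ae n : {ae mu, forall x, cell (address n x) x}.
Proof.
have mc := measurable_cell.
have null w : mu.-negligible (cell w `\` (cell (true :: w) `|` cell (false :: w))).
  have mU : measurable (cell (true :: w) `|` cell (false :: w) : set R).
    exact: measurableU.
  exists (cell w `\` (cell (true :: w) `|` cell (false :: w))); split => //.
    exact: measurableD.
  exact: mu_cell_diff.
elim: n => [|n IH].
  exists (~` cell [::]); split.
  - exact: measurableC.
  - by rewrite probability_setC // mu_cell /= subee.
  - by move=> x /= h; apply: contra_not h.
have H : {ae mu, forall x, forall w, size w = n ->
    cell w x -> cell (true :: w) x \/ cell (false :: w) x}.
  suff : {ae mu, forall x, forall w, w \in words n ->
      cell w x -> cell (true :: w) x \/ cell (false :: w) x}.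
    by apply: filterS => x h w wn; apply: h; rewrite mem_words wn.
  elim: (words n) => [|u r IHr]; first by apply: aeW.
  have [N [mN N0 sN]] := null u.
  have : {ae mu, forall x, cell u x -> cell (true :: u) x \/ cell (false :: u) x}.
    by exists N; split => // x h; apply: sN; apply: contrapT => hh; apply: h => ux;
      apply: contrapT => hc; apply: hh; split.
  apply: filterS2 IHr => x h1 h2 w; rewrite inE => /predU1P[->|wr].
    exact: h2.
  exact: h1.
apply: filterS2 IH H => x xw /(_ _ (size_address n x) xw)[|] h;
  by rewrite /= (cell_side h).
Qed.

End bernoulli.

(** * Moduli and exponentials *)

Section complex_modulus.
Context {R : realType}.
Implicit Types z : R[i].

Lemma normc_ge0 z : 0 <= normc z.
Proof. by case: z => a b; exact: sqrtr_ge0. Qed.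

Lemma normr_Re_le z : `|Re z| <= normc z.
Proof.
by case: z => a b /=; rewrite -sqrtr_sqr ler_wsqrtr // lerDl sqr_ge0.
Qed.

Lemma normr_Im_le z : `|Im z| <= normc z.
Proof.
by case: z => a b /=; rewrite -sqrtr_sqr ler_wsqrtr // lerDr sqr_ge0.
Qed.

Lemma normc_le z : normc z <= `|Re z| + `|Im z|.
Proof.
case: z => a b /=.
rewrite -[leRHS]ger0_norm ?addr_ge0 // -sqrtr_sqr ler_wsqrtr //.
rewrite sqrrD !real_normK ?num_real // lerD2r lerDl.
by rewrite mulrn_wge0 // mulr_ge0.
Qed.

Lemma Re_mulc (x y : R[i]) : Re (x * y) = Re x * Re y - Im x * Im y.
Proof. by case: x y => [? ?] []. Qed.

Lemma Im_mulc (x y : R[i]) : Im (x * y) = Re x * Im y + Im x * Re y.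
Proof. by case: x y => [? ?] []. Qed.

Lemma cexpiD (s t : R) : cexpi (s + t) = cexpi s * cexpi t.
Proof.
apply/eqP; rewrite eq_complex /= cosD sinD eqxx /= addrC.
by rewrite (mulrC (sin s)) eqxx.
Qed.

Lemma cexpi0 : cexpi 0 = 1 :> R[i].
Proof. by rewrite /cexpi cos0 sin0. Qed.

Lemma normc_cexpi (t : R) : normc (cexpi t) = 1.
Proof. by rewrite /= cos2Dsin2 sqrtr1. Qed.

Lemma normc_1Dcexpi (t : R) : normc (1 + cexpi t) = `|2 * cos (t / 2)|.
Proof.
rewrite -sqrtr_sqr /=; congr Num.sqrt.
have := cos_mulr2n (t / 2); rewrite (_ : t / 2 *+ 2 = t); last first.
  by rewrite -mulr_natr divfK ?pnatr_eq0.
have := cos2Dsin2 t; move: (cos t) (sin t) (cos (t / 2)) => c s k h1 h2.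
rewrite add0r; transitivity (1 + 2 * c + (c ^+ 2 + s ^+ 2)); first by ring.
by rewrite h1 h2; ring.
Qed.

End complex_modulus.

(** * Integrals over cells *)

Section real_integrals.
Context {R : realType}.
Context (mu : probability R R).
Implicit Types (h g : R -> R) (w v : seq bool).

Definition intg h := mu.-integrable setT (EFin \o h).

Lemma intgD h g : intg h -> intg g -> intg (fun x => h x + g x).
Proof. by move=> ih ig; apply: eq_integrable (integrableD _ ih ig) => // x _. Qed.

Lemma intgB h g : intg h -> intg g -> intg (fun x => h x - g x).
Proof. by move=> ih ig; apply: eq_integrable (integrableB _ ih ig) => // x _. Qed.

Lemma intgZ c h : intg h -> intg (fun x => c * h x).
Proof. by move=> ih; apply: eq_integrable (integrableZl _ c ih) => // x _. Qed.

Lemma intg_measurable h : intg h -> measurable_fun setT h.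
Proof. by move=> /integrableP[/measurable_EFinP]. Qed.

Lemma intg_le h g : measurable_fun setT h -> (forall x, `|h x| <= g x) ->
  intg g -> intg h.
Proof.
move=> mh hg ig; apply: le_integrable ig => //; first exact/measurable_EFinP.
move=> x _ /=; rewrite lee_fin; apply: le_trans (hg x) _; exact: ler_norm.
Qed.

Lemma intg_cst c : intg (fun=> c).
Proof. by apply: finite_measure_integrable_cst. Qed.

Lemma intg_norm h : intg h -> intg (fun x => `|h x|).
Proof. exact: integrable_norm. Qed.

Lemma intgM_bounded h g M : intg h -> measurable_fun setT g ->
  (forall x, `|g x| <= M) -> intg (fun x => h x * g x).
Proof.
move=> ih mg gM; apply: (@intg_le _ (fun x => M * `|h x|)).
- by apply: measurable_funM => //; exact: intg_measurable.
- by move=> x; rewrite normrM mulrC ler_wpM2r.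
- by apply: intgZ; exact: intg_norm.
Qed.

Lemma intgS h (D : set R) : measurable D -> intg h ->
  mu.-integrable D (EFin \o h).
Proof. by move=> mD; apply: integrableS. Qed.

Lemma Rintegral_null_diff h (D E : set R) : measurable D -> measurable E ->
  E `<=` D -> mu (D `\` E) = 0%E -> intg h ->
  \int[mu]_(x in D) h x = \int[mu]_(x in E) h x.
Proof.
move=> mD mE ED null ih; congr fine.
rewrite (negligible_integral (measurableD mD mE)) //; last exact: intgS.
by rewrite setDD setIidr.
Qed.

Definition mass h w := \int[mu]_(x in cell w) h x.

Lemma mass_le h g w : intg h -> intg g -> (forall x, cell w x -> h x <= g x) ->
  mass h w <= mass g w.
Proof.
move=> ih ig; apply: le_Rintegral; first exact: measurable_cell.
  exact: intgS (measurable_cell w) ih.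
exact: intgS (measurable_cell w) ig.
Qed.

Lemma mass_ge0 h w : (forall x, 0 <= h x) -> 0 <= mass h w.
Proof. by move=> h0; apply: Rintegral_ge0. Qed.

Lemma massZ c h w : intg h -> mass (fun x => c * h x) w = c * mass h w.
Proof.
move=> ih; apply: RintegralZl; first exact: measurable_cell.
exact: intgS (measurable_cell w) ih.
Qed.

Hypothesis hmu : is_bernoulli_convolution (4^-1) mu.

Lemma mass_cst c w : mass (fun=> c) w = c * 2^-1 ^+ size w.
Proof.
rewrite /mass Rintegral_cst; last exact: measurable_cell.
exact: (congr1 (fun z => c * fine z) (mu_cell hmu w)).
Qed.

Lemma mass_cons h w : intg h ->
  mass h w = mass h (true :: w) + mass h (false :: w).
Proof.
move=> ih; have mc := @measurable_cell R.
have mU : measurable (cell (true :: w) `|` cell (false :: w) : set R).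
  exact: measurableU.
rewrite /mass (@Rintegral_null_diff _ _ (cell (true :: w) `|` cell (false :: w))) //.
- rewrite Rintegral_setU //; first exact: intgS.
  by rewrite disj_set2E; apply/eqP; apply: cell_children_disjoint.
- by move=> x [] /cell_sub.
- exact: mu_cell_diff.
Qed.

Lemma mass_root h : intg h -> mass h [::] = \int[mu]_x h x.
Proof.
move=> ih; apply/esym; apply: Rintegral_null_diff => //; first exact: measurable_cell.
rewrite setTD; apply: etrans (probability_setC mu (measurable_cell [::])) _.
apply: etrans (congr1 (fun z => 1 - z)%E (mu_cell hmu [::])) _.
by rewrite subee.
Qed.

Lemma sum_mass h n : intg h -> \sum_(w <- words n) mass h w = \int[mu]_x h x.
Proof.
move=> ih; rewrite -mass_root //; elim: n => [|n IH].
  by rewrite /= big_cons big_nil addr0.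
rewrite big_wordsS -big_split /= -IH; apply: eq_bigr => w _.
by rewrite [in RHS]mass_cons.
Qed.

End real_integrals.

(** * Frequencies and the product formula for the kernel *)

Section frequencies.

Definition frequency n (c : {ffun 'I_n -> 'I_2}) := (\sum_(j < n) c j * 4 ^ j)%N.

Lemma frequency_rec n (c : {ffun 'I_n.+1 -> 'I_2}) :
  frequency c = (c ord0 + 4 * frequency [ffun j => c (lift ord0 j)])%N.
Proof.
rewrite /frequency big_ord_recl expn0 muln1 big_distrr /=; congr addn.
by apply: eq_bigr => j _; rewrite ffunE expnS mulnCA.
Qed.

Lemma frequency_inj n : injective (@frequency n).
Proof.
elim: n => [|n IH] c c'; first by move=> _; apply/ffunP => -[].
rewrite !frequency_rec => E.
have c4 (k : 'I_2) : (k < 4)%N by apply: ltn_trans (ltn_ord k) _.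
have E0 : c ord0 = c' ord0.
  apply/val_inj; have := congr1 (modn^~ 4) E.
  by rewrite !(addnC _ (4 * _)%N) !(mulnC 4) !modnMDl !modn_small.
move: E; rewrite E0 => /addnI/eqP; rewrite eqn_mul2l /= => /eqP/IH/ffunP Ec.
apply/ffunP => j; case: (unliftP ord0 j) => [k ->|->//].
by have := Ec k; rewrite !ffunE.
Qed.

(** The expansion in base 4 with digits 0 and 1 is unique, so a sum over the
    spectrum is a sum over digit sequences and the kernel becomes a product. *)
Lemma big_Lambda (V : nmodType) n (G : nat -> V) :
  \sum_(l <- Lambda n) G l = \sum_(c : {ffun 'I_n -> 'I_2}) G (frequency c).
Proof.
rewrite big_imfset /=; last by move=> c c' _ _; exact: frequency_inj.
by apply: congr_big => //; rewrite enumT.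
Qed.

(** The exponent [k] is the position of the lowest nonzero digit. *)
Lemma frequency_odd_or0 n (c : {ffun 'I_n -> 'I_2}) :
  frequency c = 0%N \/ exists k m, frequency c = (4 ^ k * m.*2.+1)%N.
Proof.
elim: n c => [|n IH] c; first by left; rewrite /frequency big_ord0.
rewrite frequency_rec; set c' := finfun _.
have [/eqP c0|c1] := boolP (c ord0 == ord0); last first.
  right; exists 0%N, (2 * frequency c')%N; rewrite expn0 mul1n.
  have -> : c ord0 = 1%N :> nat.
    by case: (c ord0) c1 => -[|[|]].
  by rewrite -mul2n mulnA add1n.
rewrite c0 add0n; have [->|[k [m ->]]] := IH c'; first by left.
by right; exists k.+1, m; rewrite expnS mulnA.
Qed.

End frequencies.

Section kernel_formula.
Context {R : realType}.

Definition dirichlet_ker n (t : R) : R[i] :=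
  \sum_(l <- Lambda n) cexpi (2 * pi * l%:R * t).

Lemma dirichlet_kerE n t :
  dirichlet_ker n t = \prod_(j < n) (1 + cexpi (2 * pi * 4 ^+ j * t)).
Proof.
rewrite /dirichlet_ker big_Lambda.
pose G (j : 'I_n) (b : 'I_2) : R[i] := cexpi (2 * pi * (b * 4 ^ j)%:R * t).
transitivity (\prod_(j < n) \sum_(b < 2) G j b).
  rewrite bigA_distr_bigA; apply: eq_bigr => c _.
  rewrite /frequency /G; elim/big_ind2: _ => [|x1 x2 y1 y2 E1 E2|j _] //.
    by rewrite mulr0 mul0r cexpi0.
  by rewrite natrD mulrDr mulrDl cexpiD -E1 -E2.
apply: eq_bigr => j _; rewrite big_ord_recl big_ord1 /G /= mul0n mulr0 mul0r cexpi0.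
by rewrite mul1n natrX.
Qed.

Lemma normc_dirichlet_ker n t : normc (dirichlet_ker n t) = dirichlet_prod n t.
Proof.
rewrite dirichlet_kerE /dirichlet_prod.
elim/big_ind2: _ => [|x1 x2 y1 y2 <- <-|j _].
- exact: ComplexField.Normc.normc1.
- exact: ComplexField.Normc.normcM.
- rewrite normc_1Dcexpi; congr (`|2 * cos _|).
  by field.
Qed.

End kernel_formula.

(** * Partial sums as integrals against the kernel *)

Section complex_integrals.
Context {R : realType}.
Context (mu : probability R R).
Implicit Types (f g h : R -> R[i]) (w v : seq bool).

Definition cintg h := intg mu (fun x => Re (h x)) /\ intg mu (fun x => Im (h x)).

Lemma measurable_normc h : measurable_fun setT (fun x => Re (h x)) ->
  measurable_fun setT (fun x => Im (h x)) ->
  measurable_fun setT (fun x => normc (h x)).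
Proof.
move=> mr mi.
rewrite (_ : (fun x => _) = Num.sqrt \o (fun x => Re (h x) ^+ 2 + Im (h x) ^+ 2)).
  apply: measurableT_comp; first exact: (continuous_measurable_fun (@sqrt_continuous R)).
  by apply: measurable_funD; apply: measurable_funX.
by apply/funext => x /=; case: (h x).
Qed.

Lemma cintg_normc h : cintg h -> intg mu (fun x => normc (h x)).
Proof.
move=> [ir ii]; apply: (@intg_le _ _ _ (fun x => `|Re (h x)| + `|Im (h x)|)).
- by apply: measurable_normc; [exact: intg_measurable ir|exact: intg_measurable ii].
- by move=> x; rewrite ger0_norm ?normc_ge0 ?normc_le.
- exact: intgD (intg_norm ir) (intg_norm ii).
Qed.

Lemma cintg_le h (g : R -> R) : measurable_fun setT (fun x => Re (h x)) ->
  measurable_fun setT (fun x => Im (h x)) -> (forall x, normc (h x) <= g x) ->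
  intg mu g -> cintg h.
Proof.
move=> mr mi hg ig; split; apply: intg_le ig => // x; apply: le_trans (hg x).
  exact: normr_Re_le.
exact: normr_Im_le.
Qed.

Lemma inL1_cintg f : inL1 mu f -> cintg f.
Proof.
move=> [mr mi fin]; apply: (@cintg_le _ (fun x => normc (f x))) => //.
apply/integrableP; split.
  by apply/measurable_EFinP; exact: measurable_normc.
rewrite (_ : (fun x => _) = (fun x => (normc (f x))%:E)) //.
by apply/funext => x /=; rewrite ger0_norm ?normc_ge0.
Qed.

Lemma L1normE f : cintg f -> L1norm mu f = (\int[mu]_x normc (f x))%:E.
Proof.
by move=> /cintg_normc i; rewrite /Rintegral fineK //; exact: integrable_fin_num.
Qed.

Lemma cintgD f g : cintg f -> cintg g -> cintg (fun x => f x + g x).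
Proof.
move=> [fr fi] [gr gi]; split; [have := intgD fr gr|have := intgD fi gi];
  by apply: eq_integrable => // x _ /=; case: (f x) (g x) => ? ? [].
Qed.

Lemma cintgM_bounded f g M : cintg f -> measurable_fun setT (fun x => Re (g x)) ->
  measurable_fun setT (fun x => Im (g x)) -> (forall x, normc (g x) <= M) ->
  cintg (fun x => f x * g x).
Proof.
move=> [fr fi] mr mi gM.
have rM x : `|Re (g x)| <= M := le_trans (normr_Re_le _) (gM x).
have iM x : `|Im (g x)| <= M := le_trans (normr_Im_le _) (gM x).
split.
  apply: eq_integrable (intgB (intgM_bounded fr mr rM) (intgM_bounded fi mi iM)) => //.
  by move=> x _ /=; rewrite Re_mulc.
apply: eq_integrable (intgD (intgM_bounded fr mi iM) (intgM_bounded fi mr rM)) => //.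
by move=> x _ /=; rewrite Im_mulc.
Qed.

Lemma cintgZ f c : cintg f -> cintg (fun x => f x * c).
Proof. by move=> i; apply: (@cintgM_bounded f (fun=> c) (normc c)). Qed.

Lemma cintegralD f g : cintg f -> cintg g ->
  cintegral mu (fun x => f x + g x) = cintegral mu f + cintegral mu g.
Proof.
move=> [fr fi] [gr gi]; rewrite /cintegral.
have -> : \int[mu]_x Re (f x + g x) = \int[mu]_x Re (f x) + \int[mu]_x Re (g x).
  rewrite -RintegralD //; apply: eq_Rintegral => x _.
  by case: (f x) (g x) => ? ? [].
have -> // : \int[mu]_x Im (f x + g x) = \int[mu]_x Im (f x) + \int[mu]_x Im (g x).
rewrite -RintegralD //; apply: eq_Rintegral => x _.
by case: (f x) (g x) => ? ? [].
Qed.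

Lemma cintegralZ f c : cintg f ->
  cintegral mu (fun x => f x * c) = cintegral mu f * c.
Proof.
move=> [fr fi]; apply/eqP; rewrite eq_complex Re_mulc Im_mulc /=; apply/andP; split; apply/eqP.
  rewrite -!RintegralZr // -RintegralB; try exact: measurableT.
  - by apply: eq_Rintegral => x _; rewrite Re_mulc.
  - by apply: eq_integrable (intgZ (Re c) fr) => // x _ /=; rewrite mulrC.
  - by apply: eq_integrable (intgZ (Im c) fi) => // x _ /=; rewrite mulrC.
rewrite -!RintegralZr // -RintegralD; try exact: measurableT.
- by apply: eq_Rintegral => x _; rewrite Im_mulc.
- by apply: eq_integrable (intgZ (Im c) fr) => // x _ /=; rewrite mulrC.
- by apply: eq_integrable (intgZ (Re c) fi) => // x _ /=; rewrite mulrC.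
Qed.

Lemma cintegral_sum (s : seq nat) (F : nat -> R -> R[i]) :
  (forall l, cintg (F l)) ->
  cintg (fun x => \sum_(l <- s) F l x) /\
  cintegral mu (fun x => \sum_(l <- s) F l x) = \sum_(l <- s) cintegral mu (F l).
Proof.
move=> iF; elim: s => [|l s [IHi IH]].
  have -> : (fun x => \sum_(l <- [::]) F l x) = fun=> 0.
    by apply/funext => x; rewrite big_nil.
  rewrite big_nil; split; first by split; exact: intg_cst.
  by rewrite /cintegral /= !Rintegral_cst // !mul0r.
have -> : (fun x => \sum_(l <- l :: s) F l x) =
    fun x => F l x + \sum_(l <- s) F l x.
  by apply/funext => x; rewrite big_cons.
by rewrite big_cons -IH; split; [exact: cintgD|rewrite cintegralD].
Qed.

(** The real and imaginary parts are bounded separately; the factor 2 is lost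
    only for simplicity. *)
Lemma normc_cintegral_le h : cintg h ->
  normc (cintegral mu h) <= 2 * \int[mu]_x normc (h x).
Proof.
move=> ih; have [ir ii] := ih; have iN := cintg_normc ih.
apply: le_trans (normc_le _) _; rewrite /= mulrDl mul1r; apply: lerD.
  apply: le_trans (le_normr_Rintegral _ _) _ => //.
  apply: le_Rintegral => // [|x _]; [exact: intg_norm|exact: normr_Re_le].
apply: le_trans (le_normr_Rintegral _ _) _ => //.
apply: le_Rintegral => // [|x _]; [exact: intg_norm|exact: normr_Im_le].
Qed.

Lemma measurable_cos_affine (a b : R) :
  measurable_fun setT (fun x => cos (a * x + b)).
Proof.
apply: measurableT_comp; first exact: (continuous_measurable_fun (@continuous_cos R)).
by apply: measurable_funD => //; apply: measurable_funM.
Qed.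

Lemma measurable_sin_affine (a b : R) :
  measurable_fun setT (fun x => sin (a * x + b)).
Proof.
apply: measurableT_comp; first exact: (continuous_measurable_fun (@continuous_sin R)).
by apply: measurable_funD => //; apply: measurable_funM.
Qed.

Lemma cintgM_cexpi f (a b : R) : cintg f -> cintg (fun y => f y * cexpi (a * y + b)).
Proof.
move=> i; apply: (@cintgM_bounded _ _ 1) => //.
- exact: measurable_cos_affine.
- exact: measurable_sin_affine.
- by move=> x; rewrite normc_cexpi.
Qed.

Lemma partial_sum_kernel f n x : cintg f ->
  cintg (fun y => f y * dirichlet_ker n (x - y)) /\
  partial_sum mu f n x = cintegral mu (fun y => f y * dirichlet_ker n (x - y)).
Proof.
move=> i.
pose F (l : nat) y := f y * cexpi (- (2 * pi * l%:R) * y + 2 * pi * l%:R * x).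
have iF l : cintg (F l) by exact: cintgM_cexpi.
have E : (fun y => f y * dirichlet_ker n (x - y)) = (fun y => \sum_(l <- Lambda n) F l y).
  apply/funext => y; rewrite /dirichlet_ker mulr_sumr; apply: eq_bigr => l _.
  by rewrite /F; congr (_ * cexpi _); ring.
rewrite E; have [? ->] := cintegral_sum (Lambda n) iF; split => //.
rewrite /partial_sum; apply: eq_bigr => l _.
rewrite /fourier_coef -cintegralZ; last first.
  have := cintgM_cexpi (- (2 * pi * l%:R)) 0 i.
  by congr cintg; apply/funext => y; rewrite addr0 mulNr.
congr cintegral; apply/funext => y; rewrite /F -mulrA -cexpiD.
by congr (_ * cexpi _); ring.
Qed.

Lemma partial_sumD f g n x : cintg f -> cintg g ->
  partial_sum mu (fun y => f y + g y) n x = partial_sum mu f n x + partial_sum mu g n x.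
Proof.
move=> fi gi; rewrite !(partial_sum_kernel _ _ _).2 //; last exact: cintgD.
rewrite -cintegralD; try exact: (partial_sum_kernel _ _ _).1.
by congr cintegral; apply/funext => y; rewrite mulrDl.
Qed.

Lemma partial_sumZ f c n x : cintg f ->
  partial_sum mu (fun y => f y * c) n x = partial_sum mu f n x * c.
Proof.
move=> fi; rewrite !(partial_sum_kernel _ _ _).2 //; last exact: cintgZ.
rewrite -cintegralZ; last exact: (partial_sum_kernel _ _ _).1.
by congr cintegral; apply/funext => y; rewrite mulrAC.
Qed.

Lemma partial_sumB f g n x : cintg f -> cintg g ->
  partial_sum mu (fun y => f y - g y) n x = partial_sum mu f n x - partial_sum mu g n x.
Proof.
move=> fi gi; rewrite -mulrN1 -partial_sumZ // -partial_sumD //; last exact: cintgZ.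
by congr partial_sum; apply/funext => y; rewrite mulrN1.
Qed.

Lemma cintgB f g : cintg f -> cintg g -> cintg (fun x => f x - g x).
Proof.
move=> fi gi; have := cintgD fi (cintgZ (-1) gi).
by congr cintg; apply/funext => y; rewrite mulrN1.
Qed.

Definition majorant_sum f w := majorant (fun v => mass mu (fun y => normc (f y)) v) w.

(** The link between the analysis and the tree: the masses of [|f|] on the cells
    form an additive function on words. *)
Lemma normc_partial_sum_le (hmu : is_bernoulli_convolution (4^-1) mu) f n x :
  cintg f -> cell (address n x) x ->
  normc (partial_sum mu f n x) <= 2 * majorant_sum f (address n x).
Proof.
move=> fi xw; have [iD ->] := partial_sum_kernel n x fi.
apply: le_trans (normc_cintegral_le iD) _; rewrite ler_wpM2l //.
rewrite -(sum_mass hmu n) /majorant_sum /majorant ?size_address; last exact: cintg_normc.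
apply: ler_sum_words => v vn _; have iN := cintg_normc fi.
rewrite -massZ //; apply: mass_le; [exact: cintg_normc|exact: intgZ|] => y yv.
have [le _] := dirichlet_prod_le (etrans (size_address n x) (esym vn)) xw yv.
rewrite ComplexField.Normc.normcM mulrC ler_wpM2r ?normc_ge0 //.
by rewrite normc_dirichlet_ker; move: le; rewrite size_address.
Qed.

Lemma measurable_partial_sum f n :
  measurable_fun setT (fun x => Re (partial_sum mu f n x)) /\
  measurable_fun setT (fun x => Im (partial_sum mu f n x)).
Proof.
rewrite /partial_sum; elim: (enum_fset (Lambda n)) => [|l s [IHr IHi]].
  by split; rewrite (_ : (fun x => _) = cst 0) //; apply/funext => x; rewrite big_nil.
split.
  rewrite (_ : (fun x => _) = (fun x =>
    (Re (fourier_coef mu f l) * cos (2 * pi * l%:R * x + 0)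
     - Im (fourier_coef mu f l) * sin (2 * pi * l%:R * x + 0))
    + Re (\sum_(j <- s) fourier_coef mu f j * cexpi (2 * pi * j%:R * x)))).
    apply: measurable_funD => //; apply: measurable_funB; apply: measurable_funM => //.
      exact: measurable_cos_affine.
    exact: measurable_sin_affine.
  apply/funext => x; rewrite big_cons addr0 -[RHS]/(_ + _); case: (\sum_(_ <- _) _) => a b.
  by case: (fourier_coef _ _ _).
rewrite (_ : (fun x => _) = (fun x =>
  (Re (fourier_coef mu f l) * sin (2 * pi * l%:R * x + 0)
   + Im (fourier_coef mu f l) * cos (2 * pi * l%:R * x + 0))
  + Im (\sum_(j <- s) fourier_coef mu f j * cexpi (2 * pi * j%:R * x)))).
  apply: measurable_funD => //; apply: measurable_funD; apply: measurable_funM => //.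
    exact: measurable_sin_affine.
  exact: measurable_cos_affine.
apply/funext => x; rewrite big_cons addr0; case: (\sum_(_ <- _) _) => a b.
by case: (fourier_coef _ _ _).
Qed.

End complex_integrals.

(** * The maximal operator *)

Section maximal.
Context {R : realType} (mu : probability R R).
Hypothesis hmu : is_bernoulli_convolution (4^-1) mu.
Implicit Types (f g h : R -> R[i]) (w v : seq bool).

Lemma mu_cells_le n (s : seq (seq bool)) (B : pred (seq bool)) :
  (forall w, w \in s -> size w = n) ->
  measurable (\big[setU/set0]_(w <- s | B w) cell w : set R) /\
  (mu (\big[setU/set0]_(w <- s | B w) cell w)
     <= ((\sum_(w <- s | B w) 1) / 2 ^+ n)%:E)%E.
Proof.
elim: s => [|u s IH] sn.
  by rewrite !big_nil mul0r measure0; split.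
have [m1 le1] := IH (fun w ws => sn w (mem_behead (s := u :: s) ws)).
rewrite !big_cons; case: ifP => // Bu; have mc := @measurable_cell R u.
split; first exact: measurableU.
apply: le_trans (measureU2 mu mc m1) _; rewrite mulrDl EFinD; apply: leeD le1.
suff : (mu (cell u) <= (1 / 2 ^+ n)%:E)%E by [].
by rewrite (mu_cell hmu) (sn u) ?inE ?eqxx // div1r exprVn.
Qed.

Lemma measurable_partial_sum_gt f n (al : R) :
  measurable [set x | al < normc (partial_sum mu f n x)].
Proof.
have [mr mi] := measurable_partial_sum mu f n.
have := measurable_normc mr mi.
move=> /(_ measurableT `]al, +oo[%classic (measurable_itv _)).
by rewrite setTI; congr measurable; apply/seteqP; split => x /=; rewrite in_itv /= andbT.
Qed.

(** Up to level [k] the set is covered, almost everywhere, by cells of level [k]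
    to which the counting inequality applies.  The constant is [11 * 22], where
    22 combines the threshold [11 * al] on words and the factor 2 between a
    partial sum and its majorant. *)
Lemma weak_type_upto f (al : R) k : cintg mu f -> 0 < al ->
  (mu (\big[setU/set0]_(n < k) [set x | (al < normc (partial_sum mu f n.+1 x))%R])
    <= (242 / al)%:E * L1norm mu f)%E.
Proof.
move=> fi al0; set M := \big[setU/set0]_(n < k) _.
have iN := cintg_normc fi.
pose F v := mass mu (fun y => normc (f y)) v.
have F0 v : 0 <= F v by apply: mass_ge0 => x; exact: normc_ge0.
pose B w := `[< exists2 n, (n <= k)%N & 11 * (al / 22) < majorant F (drop (k - n) w) >].
have al22 : 0 < al / 22 by rewrite divr_gt0.
have cnt := @weak_type_words R F (al / 22) F0 (fun w => mass_cons hmu w iN) al22 k B.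
have {}cnt := cnt (fun w _ Bw => asboolW Bw).
have wk w : w \in words k -> size w = k by rewrite mem_words => /eqP.
have [mU leU] := @mu_cells_le k (words k) B wk.
have [N [mN N0 sN]] := cell_cover_ae hmu k.
have mM : measurable M.
  by apply: bigsetU_measurable => n _; exact: measurable_partial_sum_gt.
pose U : set R := \big[setU/set0]_(w <- words k | B w) cell w.
have MU : M `<=` U `|` N.
  move=> x Mx; have [xc|xc] := pselect (cell (address k x) x); last first.
    by right; apply: sN.
  left; rewrite /U -bigcup_seq_cond; exists (address k x) => //=.
  rewrite mem_words size_address eqxx /=; apply/asboolP.
  move: Mx; rewrite /M -(bigcup_mkord k (fun n =>
    [set x | (al < normc (partial_sum mu f n.+1 x))%R])) => -[n /= nk aln].
  exists n.+1 => //; have nE : ((k - n.+1) + n.+1)%N = k by rewrite subnK.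
  rewrite -[in address k x]nE drop_address.
  have xn : cell (address n.+1 x) x.
    rewrite -(drop_address (k - n.+1)) nE.
    elim: (k - n.+1)%N => [|m IH]; first by rewrite drop0.
    have [mk|mk] := ltnP m (size (address k x)); last first.
      by rewrite drop_oversize 1?(leqW mk) // -(drop_oversize mk).
    by move: IH; rewrite (drop_nth false mk) => /cell_sub.
  have := normc_partial_sum_le hmu fi xn.
  move: (partial_sum mu f n.+1 x) aln => z; rewrite /majorant_sum -/F; lra.
apply: (@le_trans _ _ (mu (U `|` N))).
  by apply: le_measure; rewrite ?inE //; exact: measurableU.
apply: le_trans (measureU2 _ mU mN) _.
rewrite [X in (_ + X <= _)%E](_ : _ = 0%E) ?adde0 //.
apply: le_trans leU _; rewrite L1normE // -EFinM lee_fin.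
have root : F [::] = \int[mu]_x normc (f x) by rewrite /F mass_root.
rewrite -root ler_pdivrMr ?exprn_gt0 //.
rewrite -(ler_pM2l al22); apply: le_trans cnt _.
rewrite le_eqVlt; apply/orP; left; apply/eqP; field.
by rewrite gt_eqF.
Qed.

Lemma maximal_gt_bigcup f (al : R) : 0 < al ->
  [set x | (al%:E < `|maximal_op mu f x|)%E]
    = \bigcup_n [set x | (al < normc (partial_sum mu f n.+1 x))%R].
Proof.
move=> al0; have S0 x : (0 <= maximal_op mu f x)%E.
  apply: (@le_trans _ _ (normc (partial_sum mu f 1 x))%:E).
    by rewrite lee_fin normc_ge0.
  by apply: ereal_sup_ubound; exists 1%N.
apply/seteqP; split => x /=; rewrite gee0_abs //.
  by move=> /ereal_sup_gt[_ [[|n] // _ <-]]; rewrite lte_fin; exists n.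
move=> [n _ /= aln]; apply: (@lt_le_trans _ _ (normc (partial_sum mu f n.+1 x))%:E).
  by rewrite lte_fin.
by apply: ereal_sup_ubound; exists n.+1.
Qed.

(** The sets of the truncated maximal function increase to the set of the full
    one, and the bound does not depend on the truncation. *)
Lemma weak_type_maximal f (al : R) : cintg mu f -> 0 < al ->
  measurable [set x | (al%:E < `|maximal_op mu f x|)%E] /\
  (mu [set x | (al%:E < `|maximal_op mu f x|)%E]
    <= (242 / al)%:E * L1norm mu f)%E.
Proof.
move=> fi al0; rewrite maximal_gt_bigcup //.
pose A n := [set x | (al < normc (partial_sum mu f n.+1 x))%R].
have mA n : measurable (A n) by exact: measurable_partial_sum_gt.
have mUA : measurable (\bigcup_n A n) by exact: bigcup_measurable.
split => //.
pose G k := \big[setU/set0]_(n < k.+1) A n.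
have GA : \bigcup_k G k = \bigcup_n A n by exact: bigcup_bigsetU_bigcup.
have cv : mu \o G @ \oo --> mu (\bigcup_n A n).
  rewrite -GA; apply: nondecreasing_cvg_mu; rewrite ?GA //.
    by move=> k; exact: bigsetU_measurable.
  by move=> m n mn; apply/subsetPset; apply: subset_bigsetU.
rewrite -(cvg_lim _ cv) //; apply: lime_le; first by apply/cvg_ex; eexists; exact: cv.
by apply: nearW => k; exact: weak_type_upto.
Qed.

End maximal.

(** * Orthogonality of the frequencies *)

Section orthogonality.
Context {R : realType} (mu : probability R R).
Hypothesis hmu : is_bernoulli_convolution (4^-1) mu.
Implicit Types (w v : seq bool).

Lemma sum_cos_midpointS (th ph : R) n :
  \sum_(w <- words n.+1) cos (th * midpoint w + ph)
  = 2 * cos (th * 4^-1 ^+ n.+1) * \sum_(w <- words n) cos (th * midpoint w + ph).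
Proof.
rewrite big_wordsS -big_split mulr_sumr; apply: eq_big_words => // w wn _ /=.
rewrite wn /digit; set q := 4^-1 ^+ _.
rewrite (_ : th * (_ + 1 * q) + ph = (th * midpoint w + ph) + th * q); last by ring.
rewrite (_ : th * (_ + -1 * q) + ph = (th * midpoint w + ph) - th * q); last by ring.
rewrite cosD cosB; ring.
Qed.

Lemma le0_geometric (a K q : R) n0 : 0 <= q < 1 ->
  (forall n, (n0 <= n)%N -> a <= K * q ^+ n) -> a <= 0.
Proof.
move=> /andP[q0 q1] H.
have cv : (fun n => K * q ^+ n) @ \oo --> K * 0.
  by apply: cvgMr; apply: cvg_expr; rewrite ger0_norm.
rewrite -(mulr0 K); apply: (ler_cvg_to (cvg_cst a) cv).
by near=> n; apply: H; near: n; exact: nbhs_infty_ge.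
Unshelve. all: by end_near. Qed.

Lemma intg_cos_affine (th ph : R) : intg mu (fun x => cos (th * x + ph)).
Proof.
apply: (@intg_le _ _ _ (fun=> 1)); [exact: measurable_cos_affine| |exact: intg_cst].
by move=> x; exact: cos_max.
Qed.

(** The integral is the limit of the means over the midpoints of level [n], which
    factor into cosines of [th * 4^-j].  For [th = 2 pi 4^k (2 m + 1)] the one
    with [j = k + 1] is the cosine of an odd multiple of [pi / 2], so the means
    vanish from level [k + 1] on.  The phase [ph] covers sines too. *)
Lemma integral_cos_eq0 k m (ph : R) :
  \int[mu]_x cos (2 * pi * (4 ^ k * m.*2.+1)%N%:R * x + ph) = 0.
Proof.
set th := 2 * pi * _; pose h x := cos (th * x + ph).
have ih : intg mu h by exact: intg_cos_affine.
have sum0 j : \sum_(w <- words (j + k.+1)) h (midpoint w) = 0.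
  elim: j => [|j IH]; last by rewrite sum_cos_midpointS IH mulr0.
  rewrite add0n sum_cos_midpointS (_ : cos (th * _) = 0) ?mulr0 ?mul0r //.
  rewrite (_ : th * _ = pi / 2 + pi *+ m).
    by rewrite (alternatingn (@cosDpi R)) cos_pihalf mulr0.
  have -> : th = 2 * pi * (4 ^+ k * (2 * m%:R + 1)).
    by rewrite /th natrM natrX -(addn1 m.*2) natrD -mul2n natrM.
  rewrite exprS exprVn -mulr_natr.
  have p : (4 : R) ^+ k != 0 by rewrite expf_neq0 ?pnatr_eq0.
  by field.
apply/eqP; rewrite -normr_le0; apply: (@le0_geometric _ `|th| 4^-1 k.+1).
  by apply/andP; split; lra.
move=> n /subnK <-; move: (n - k.+1)%N => {}n.
rewrite -(sum_mass hmu (n + k.+1)) //.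
have E : \sum_(w <- words (n + k.+1)) mass mu h w =
  \sum_(w <- words (n + k.+1)) mass mu (fun x => h x - h (midpoint w)) w.
  transitivity (\sum_(w <- words (n + k.+1)) mass mu h w
      - 2^-1 ^+ (n + k.+1) * \sum_(w <- words (n + k.+1)) h (midpoint w)).
    by rewrite sum0 mulr0 subr0.
  rewrite mulr_sumr -sumrB.
  apply: eq_big_words => // w wn _; rewrite /mass RintegralB.
  - by rewrite -/(mass mu _ w) -/(mass mu _ w) (mass_cst hmu) wn mulrC.
  - exact: measurable_cell.
  - exact: intgS (measurable_cell w) ih.
  - exact: intgS (measurable_cell w) (intg_cst _ _).
rewrite E; apply: le_trans (ler_norm_sum _ _ _) _.
have half1 N : (2^-1 : R) ^+ N *+ (2 ^ N)%N = 1.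
  by rewrite -mulr_natr natrX -exprMn mulVf ?pnatr_eq0 // expr1n.
apply: (@le_trans _ _ (\sum_(w <- words (n + k.+1))
  `|th| * 4^-1 ^+ (n + k.+1) * 2^-1 ^+ (n + k.+1))); last first.
  by rewrite big_const_seq count_predT size_words iter_addr_0 -mulrnAr half1 mulr1.
apply: ler_sum_words => w wn _; rewrite -[in leRHS]wn -(mass_cst hmu).
have ihc : intg mu (fun x => h x - h (midpoint w)) by exact: intgB ih (intg_cst _ _).
apply: le_trans (le_normr_Rintegral _ _) _ => //; first exact: measurable_cell.
  exact: intgS (measurable_cell w) ihc.
apply: mass_le; [exact: intg_norm|exact: intg_cst|move=> x].
rewrite /cell /= => xw; apply: le_trans (lipschitz_cos _ _) _.
rewrite (_ : _ - _ = th * (x - midpoint w)) ?normrM; last by ring.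
rewrite ler_wpM2l //; apply: le_trans xw _.
have := exp4V_gt0 (R := R) (size w); lra.
Qed.

Lemma fourier_coef_cst0 : fourier_coef mu (fun=> 1) 0 = 1.
Proof.
rewrite /fourier_coef (_ : (fun x => _) = fun=> 1); last first.
  by apply/funext => x; rewrite mulr0 mul0r oppr0 cexpi0 mulr1.
rewrite /cintegral /= !Rintegral_cst // mul0r mul1r.
by rewrite (congr1 fine (probability_setT mu)).
Qed.

Lemma fourier_coef_cst k m : fourier_coef mu (fun=> 1) (4 ^ k * m.*2.+1)%N = 0.
Proof.
rewrite /fourier_coef /cintegral.
rewrite (@eq_Rintegral _ _ _ _ _ (fun x =>
  cos (2 * pi * (4 ^ k * m.*2.+1)%N%:R * x + 0))); last first.
  by move=> x _; rewrite mul1r /= cosN addr0.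
rewrite integral_cos_eq0 (@eq_Rintegral _ _ _ _ _ (fun x =>
  cos (2 * pi * (4 ^ k * m.*2.+1)%N%:R * x + pi / 2))).
  by rewrite integral_cos_eq0.
by move=> x _; rewrite mul1r /= sinN cosDpihalf.
Qed.

Lemma partial_sum_cst n x : partial_sum mu (fun=> 1) n x = 1.
Proof.
rewrite /partial_sum big_Lambda (bigD1 [ffun=> ord0]) //=.
have f0 : @frequency n [ffun=> ord0] = 0%N.
  by apply: big1 => j _; rewrite ffunE.
rewrite f0 fourier_coef_cst0 mul1r mulr0 mul0r cexpi0 big1 ?addr0 // => c c0.
have [E|[k [m E]]] := frequency_odd_or0 c; last by rewrite E fourier_coef_cst mul0r.
by move/eqP: c0; case; apply: frequency_inj; rewrite E f0.
Qed.

End orthogonality.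

(** * Partial sums of step functions *)

Section step_functions.
Context {R : realType} (mu : probability R R).
Hypothesis hmu : is_bernoulli_convolution (4^-1) mu.
Implicit Types (w v : seq bool).

Lemma measurable_address d (T : measurableType d) q (c : seq bool -> T) :
  measurable_fun setT (fun x : R => c (address q x)).
Proof.
elim: q d T c => [|q IH] d T c; first apply: (@measurable_cst _ _ R T setT (c [::])).
rewrite (_ : (fun x => _) = (fun x => if midpoint (address q x) < x
   then c (true :: address q x) else c (false :: address q x))).
  apply: measurable_fun_ifT.
  - by apply: measurable_fun_ltr => //; exact: (IH _ _ midpoint).
  - exact: (IH _ _ (fun w => c (true :: w))).
  - exact: (IH _ _ (fun w => c (false :: w))).
by apply/funext => x /=; case: ifP.
Qed.

Lemma step_bounded q (c : seq bool -> R[i]) (x : R) :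
  normc (c (address q x)) <= \sum_(w <- words q) normc (c w).
Proof.
rewrite (bigD1_seq (address q x)) ?uniq_words ?mem_words ?size_address //=.
by rewrite lerDl sumr_ge0 // => w _; exact: normc_ge0.
Qed.

Lemma cintg_step q (c : seq bool -> R[i]) :
  cintg mu (fun x : R => c (address q x)).
Proof.
apply: cintg_le (intg_cst mu _); last exact: step_bounded.
  exact: (@measurable_address _ _ q (fun w => Re (c w))).
exact: (@measurable_address _ _ q (fun w => Im (c w))).
Qed.

(** Subtracting the constant [c (address q x)], which partial sums reproduce,
    leaves a step function that vanishes on the cell of [x] at level [q].  Only
    the words that differ from the address of [x] at that level contribute;
    their total kernel grows like [(9 / 5)^L] against the [2^-L] of their
    masses. *)
Lemma partial_sum_step_rate q (c : seq bool -> R[i]) (x : R) :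
  (forall n, cell (address n x) x) ->
  exists K : R, forall L,
    normc (partial_sum mu (fun y => c (address q y)) (L + q) x - c (address q x))
      <= K * (9 / 10) ^+ L.
Proof.
move=> xc; pose c' w := c w - c (address q x).
pose M := \sum_(w <- words q) normc (c' w).
exists (2 * M * 45) => L; set n := (L + q)%N.
have -> : partial_sum mu (fun y => c (address q y)) n x - c (address q x)
    = partial_sum mu (fun y => c' (address q y)) n x.
  rewrite /c' (partial_sumB n x (cintg_step q c) (cintg_step q (fun=> c (address q x)))).
  congr (_ - _); rewrite (_ : (fun=> _) = (fun=> 1 * c (address q x))); last first.
    by rewrite mul1r.
  by rewrite partial_sumZ ?partial_sum_cst ?mul1r //; exact: (cintg_step 0 (fun=> 1)).
have i' := cintg_step q c'.
apply: le_trans (normc_partial_sum_le hmu i' (xc n)) _.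
rewrite -!mulrA ler_wpM2l //.
set w := address n x; have wn : size w = n by rewrite size_address.
have dw : drop L w = address q x by exact: drop_address.
rewrite /majorant_sum /majorant wn.
have massE v : size v = n -> mass mu (fun y => normc (c' (address q y))) v
    = normc (c' (drop L v)) * 2^-1 ^+ n.
  move=> vn; rewrite -vn -(mass_cst hmu); apply: eq_Rintegral => y.
  rewrite inE => /(address_cell vn) <-; by rewrite drop_address.
rewrite (bigID (fun v => drop L v == drop L w)) /= big1_seq ?add0r; last first.
  move=> v /andP[/eqP vw]; rewrite mem_words => /eqP vn.
  by rewrite massE // vw dw /c' subrr ComplexField.Normc.normc0 mul0r mulr0.
have M0 : 0 <= M by rewrite sumr_ge0 // => v _; exact: normc_ge0.
apply: (@le_trans _ _ (\sum_(v <- words n | drop L v != drop L w)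
  M * 2^-1 ^+ n * kpot w v)).
  apply: ler_sum_words => v vn vw; rewrite massE // mulrC.
  have wv : size w = size v by rewrite wn.
  apply: ler_pM; [|exact: kmaj_ge0| |].
  - by rewrite mulr_ge0 ?normc_ge0 // exprn_ge0.
  - rewrite ler_wpM2r ?exprn_ge0 //.
    rewrite /M (bigD1_seq (drop L v)) ?uniq_words ?mem_words ?size_drop ?vn ?addKn //=.
    by rewrite lerDl sumr_ge0 // => u _; exact: normc_ge0.
  - by apply: kmaj_le_kpot => //; apply: contraNneq vw => ->.
rewrite -mulr_sumr; apply: le_trans (ler_wpM2l _ (sum_kpot_drop wn)) _.
  by rewrite mulr_ge0 // exprn_ge0.
rewrite le_eqVlt; apply/orP; left; apply/eqP.
have -> : 9 / 10 = 2^-1 * (9 / 5) :> R by field.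
rewrite [in RHS]exprMn /n exprD !exprVn.
have p j : (2 : R) ^+ j != 0 by rewrite expf_neq0 ?pnatr_eq0.
have := p L; have := p q; move: (2 ^+ L) (2 ^+ q) ((9 / 5) ^+ L) => a b r ? ?.
by field; apply/andP.
Qed.

End step_functions.

(** * Approximation of measurable sets by unions of cells *)

Section density.
Context {R : realType} (mu : probability R R).
Hypothesis hmu : is_bernoulli_convolution (4^-1) mu.
Implicit Types (w v : seq bool).

Lemma half_pow_small (e : R) : 0 < e -> exists n, 2^-1 ^+ n <= e.
Proof.
move=> e0; apply: contrapT => H; suff : e <= 0 by rewrite leNgt e0.
apply: (@le0_geometric _ _ 1 2^-1 0); first by apply/andP; split; lra.
move=> n _; rewrite mul1r ltW // ltNge; apply/negP => le; apply: H.
by exists n.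
Qed.

Definition union_of_cells q (c : pred (seq bool)) : set R :=
  [set x | c (address q x)].

Lemma measurable_union_of_cells q c : measurable (union_of_cells q c).
Proof.
have := @measurable_address R _ bool q c.
move=> /(_ measurableT [set true] I); rewrite setTI; congr measurable.
Qed.

Lemma union_of_cells_lift k q c :
  union_of_cells q c = union_of_cells (k + q) (fun w => c (drop k w)).
Proof. by apply/seteqP; split => x; rewrite /union_of_cells /= drop_address. Qed.

Definition symdiff (A B : set R) := (A `\` B) `|` (B `\` A).

Lemma measurable_symdiff A B : measurable A -> measurable B -> measurable (symdiff A B).
Proof. by move=> mA mB; apply: measurableU; exact: measurableD. Qed.

Definition approximable (A : set R) := measurable A /\
  forall e : R, 0 < e -> exists q c, (mu (symdiff A (union_of_cells q c)) <= e%:E)%E.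

Lemma approximableU A B : approximable A -> approximable B -> approximable (A `|` B).
Proof.
move=> [mA hA] [mB hB]; split; first exact: measurableU.
move=> e e0; have e2 : 0 < e / 2 by lra.
have [q [c le1]] := hA _ e2; have [q' [c' le2]] := hB _ e2.
exists (q' + q)%N, (fun w => c (drop q' w) || c' (drop q w)).
rewrite (union_of_cells_lift q') in le1; rewrite (union_of_cells_lift q) addnC in le2.
have mS := @measurable_union_of_cells.
apply: (@le_trans _ _ (mu (symdiff A (union_of_cells (q' + q) (fun w => c (drop q' w)))
  `|` symdiff B (union_of_cells (q' + q) (fun w => c' (drop q w)))))).
  apply: le_measure; rewrite ?inE.
  - by apply: measurable_symdiff => //; exact: measurableU.
  - by apply: measurableU; exact: measurable_symdiff.
  - move=> x; rewrite /symdiff /union_of_cells /=.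
    by case: (c _); case: (c' _) => /=; have := isT; have : ~ false by []; tauto.
rewrite [e]splitr EFinD; apply: le_trans (measureU2 _ _ _) _; try exact: measurable_symdiff.
exact: leeD.
Qed.

Lemma approximable_set0 : approximable set0.
Proof.
split => // e e0; exists 0%N, xpred0.
rewrite (_ : symdiff _ _ = set0) ?measure0 ?lee_fin ?ltW //.
by apply/seteqP; split => // x [[]|[]].
Qed.

Lemma approximableC A : approximable A -> approximable (~` A).
Proof.
move=> [mA hA]; split; first exact: measurableC.
move=> e e0; have [q [c le]] := hA e e0; exists q, (predC c).
rewrite (_ : symdiff _ _ = symdiff A (union_of_cells q c)) //.
apply/seteqP; split => x; rewrite /symdiff /union_of_cells /= ;
  by have [] := pselect (A x); case: (c _) => /=; have := isT; have : ~ false by []; tauto.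
Qed.

(** A countable union is exhausted in measure by finite ones. *)
Lemma approximable_bigcup (F : (set R)^nat) : (forall n, approximable (F n)) ->
  approximable (\bigcup_n F n).
Proof.
move=> aF; have mF n : measurable (F n) := (aF n).1.
have mU : measurable (\bigcup_n F n) by exact: bigcup_measurable.
split => // e e0; have e2 : 0 < e / 2 by lra.
pose G k := \big[setU/set0]_(n < k.+1) F n.
have aG k : approximable (G k).
  rewrite /G; elim: k.+1 => [|j IH]; first by rewrite big_ord0; exact: approximable_set0.
  by rewrite big_ord_recr /=; exact: approximableU.
have GA : \bigcup_k G k = \bigcup_n F n by exact: bigcup_bigsetU_bigcup.
have cv : mu (\bigcup_n F n `\` G k) @[k --> \oo] --> 0%E.
  have -> : 0%E = mu (\bigcap_k (\bigcup_n F n `\` G k)).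
    rewrite (_ : \bigcap_k _ = set0) ?measure0 //.
    apply/seteqP; split => // x H; have [+ _] := H 0%N I.
    by rewrite -GA => -[k _ Gx]; have [_] := H k I.
  apply: (@nonincreasing_cvg_mu _ _ _ mu (fun k => \bigcup_n F n `\` G k)).
  - apply: le_lt_trans (probability_le1 mu _) _; rewrite ?ltry //.
    by apply: measurableD => //; exact: (aG 0%N).1.
  - by move=> k; apply: measurableD => //; exact: (aG k).1.
  - apply: bigcap_measurable => // k _; apply: measurableD => //; exact: (aG k).1.
  - move=> m n mn; apply/subsetPset; apply: setDS; exact: subset_bigsetU.
have [k le1] : exists k, (mu (\bigcup_n F n `\` G k) <= (e / 2)%:E)%E.
  have [k _ /(_ k (leqnn k))] : \forall k \near \oo,
      (mu (\bigcup_n F n `\` G k) < (e / 2)%:E)%E.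
    apply: (cv [set y : \bar R | (y < (e / 2)%:E)%E]).
    by apply: open_ereal_lt'; rewrite lte_fin.
  by move=> /ltW; exists k.
have [q [c le2]] := (aG k).2 _ e2; exists q, c.
have mS := @measurable_union_of_cells q c; have mG := (aG k).1.
apply: (@le_trans _ _ (mu ((\bigcup_n F n `\` G k)
  `|` symdiff (G k) (union_of_cells q c)))).
  apply: le_measure; rewrite ?inE.
  - exact: measurable_symdiff.
  - by apply: measurableU; [exact: measurableD|exact: measurable_symdiff].
  - move=> x; have : G k x -> (\bigcup_n F n) x by rewrite -GA; exists k.
    by rewrite /symdiff /=; have [] := pselect (G k x); tauto.
rewrite [e]splitr EFinD; apply: le_trans (measureU2 _ _ _) _.
- exact: measurableD.
- exact: measurable_symdiff.
- exact: leeD.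
Qed.

(** Comparing [a] with the midpoints decides correctly on every cell but the one
    that contains [a]. *)
Lemma approximable_ray (a : R) : approximable `]a, +oo[%classic.
Proof.
split => // e e0; have [q qe] := half_pow_small e0.
pose c w := a < midpoint w; exists q, c.
have [N [mN N0 sN]] := cell_cover_ae hmu q.
have mc := @measurable_cell R (address q a).
apply: (@le_trans _ _ (mu (cell (address q a) `|` N))).
  apply: le_measure; rewrite ?inE.
  - apply: measurable_symdiff => //; exact: measurable_union_of_cells.
  - exact: measurableU.
  - move=> x; have [xc|xc _] := pselect (cell (address q x) x); last by right; apply: sN.
    rewrite /symdiff /union_of_cells /= in_itv /= andbT => d; left.
    suff ac : cell (address q x) a.
      by rewrite (address_cell (size_address q x) ac).
    move: xc d; rewrite /cell /c /=; move: (midpoint _) (4^-1 ^+ _ / 3) => m r.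
    rewrite !ler_norml => /andP[h1 h2] [[h3 /negP]|[h3 /negP]];
      by rewrite -leNgt => h4; apply/andP; split; lra.
apply: le_trans (measureU2 _ mc mN) _.
rewrite [X in (_ + X <= _)%E](_ : _ = 0%E) ?adde0 //.
suff : (mu (cell (address q a)) <= e%:E)%E by [].
by rewrite (mu_cell hmu) size_address lee_fin.
Qed.

Lemma measurable_approximable A : measurable A -> approximable A.
Proof.
suff : (@RGenOInfty.G R).-sigma.-measurable `<=` approximable.
  by rewrite -RGenOInfty.measurableE; apply.
apply: smallest_sub.
  split; [exact: approximable_set0| |exact: approximable_bigcup].
  by move=> B; rewrite setTD; exact: approximableC.
by move=> B [a ->]; exact: approximable_ray.
Qed.

End density.

(** * Density of step functions *)

Section approximation.
Context {R : realType} (mu : probability R R).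
Hypothesis hmu : is_bernoulli_convolution (4^-1) mu.
Implicit Types (w v : seq bool) (h g : R -> R).

Lemma intg_step q (c : seq bool -> R) : intg mu (fun x : R => c (address q x)).
Proof. exact: (cintg_step mu q (fun w => (c w)%:C)).1. Qed.

Definition step_dense h := forall e : R, 0 < e ->
  exists q (c : seq bool -> R), \int[mu]_x `|h x - c (address q x)| <= e.

Lemma step_dense_indic A : measurable A -> step_dense (\1_A).
Proof.
move=> mA e e0; have [_ /(_ _ e0)[q [c le]]] := measurable_approximable hmu mA.
exists q, (fun w => (c w)%:R).
have mS := measurable_symdiff mA (@measurable_union_of_cells R q c).
have -> : \int[mu]_x `|\1_A x - (c (address q x))%:R| =
    fine (mu (symdiff A (union_of_cells q c))).
  rewrite -[in RHS](setIT (symdiff _ _)) -integral_indic //; congr fine.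
  apply: eq_integral => x _; congr EFin; rewrite !indicE /symdiff.
  have cE : (x \in union_of_cells q c) = c (address q x).
    by apply/idP/idP; rewrite inE.
  rewrite in_setU !in_setD cE; case: (x \in A); case: (c _) => /=.
  - by rewrite subrr normr0.
  - by rewrite subr0 normr1.
  - by rewrite sub0r normrN normr1.
  - by rewrite subr0 normr0.
have fin : mu (symdiff A (union_of_cells q c)) \is a fin_num.
  exact: fin_num_measure.
by rewrite -lee_fin fineK.
Qed.

Lemma step_denseD h g : intg mu h -> intg mu g ->
  step_dense h -> step_dense g -> step_dense (fun x => h x + g x).
Proof.
move=> ih ig dh dg e e0; have e2 : 0 < e / 2 by lra.
have [q [c le1]] := dh _ e2; have [q' [c' le2]] := dg _ e2.
exists (q' + q)%N, (fun w => c (drop q' w) + c' (drop q w)).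
have i1 := intg_norm (intgB ih (intg_step q c)).
have i2 := intg_norm (intgB ig (intg_step q' c')).
apply: (@le_trans _ _ (\int[mu]_x (`|h x - c (address q x)|
    + `|g x - c' (address q' x)|))).
  apply: le_Rintegral => //.
  - exact: intg_norm (intgB (intgD ih ig)
      (intg_step _ (fun w => c (drop q' w) + c' (drop q w)))).
  - exact: intgD i1 i2.
  - move=> x _; rewrite drop_address addnC drop_address.
    by rewrite opprD addrACA; exact: ler_normD.
by rewrite RintegralD // [e]splitr lerD.
Qed.

Lemma step_denseZ (k : R) h : intg mu h -> step_dense h ->
  step_dense (fun x => k * h x).
Proof.
move=> ih dh e e0; have k0 : 0 < `|k| + 1 by rewrite ltr_wpDl.
have [q [c le1]] := dh _ (divr_gt0 e0 k0).
exists q, (fun w => k * c w).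
have i1 := intg_norm (intgB ih (intg_step q c)).
have -> : \int[mu]_x `|k * h x - k * c (address q x)| =
    `|k| * \int[mu]_x `|h x - c (address q x)|.
  by rewrite -RintegralZl //; apply: eq_Rintegral => x _; rewrite -mulrBr normrM.
apply: le_trans (ler_wpM2l (normr_ge0 k) le1) _.
rewrite mulrCA ler_piMr ?ltW // ltr_pdivrMr // mul1r; lra.
Qed.

Lemma step_dense_limit h : intg mu h ->
  (forall e : R, 0 < e -> exists g, [/\ intg mu g, step_dense g &
     \int[mu]_x `|h x - g x| <= e]) -> step_dense h.
Proof.
move=> ih H e e0; have e2 : 0 < e / 2 by lra.
have [g [ig dg le1]] := H _ e2; have [q [c le2]] := dg _ e2; exists q, c.
have i1 := intg_norm (intgB ih ig).
have i2 := intg_norm (intgB ig (intg_step q c)).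
apply: (@le_trans _ _ (\int[mu]_x (`|h x - g x| + `|g x - c (address q x)|))).
  apply: le_Rintegral => //.
  - exact: intg_norm (intgB ih (intg_step q c)).
  - exact: intgD i1 i2.
  - by move=> x _; exact: ler_distD.
by rewrite RintegralD // [e]splitr lerD.
Qed.

Lemma intg_indic A : measurable A -> intg mu (\1_A).
Proof.
move=> mA; apply: (@intg_le _ _ _ (fun=> 1)); [exact: measurable_indic| |exact: intg_cst].
by move=> x; rewrite indicE; case: (_ \in _); rewrite ?normr1 ?normr0.
Qed.

Lemma step_dense_sum (I : Type) (s : seq I) (F : I -> R -> R) :
  (forall i, intg mu (F i) /\ step_dense (F i)) ->
  intg mu (fun x => \sum_(i <- s) F i x) /\
  step_dense (fun x => \sum_(i <- s) F i x).
Proof.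
move=> HF; elim: s => [|i s [IH1 IH2]].
  rewrite (_ : (fun x => _) = fun=> 0); last by apply/funext => x; rewrite big_nil.
  split; first exact: intg_cst.
  move=> e e0; exists 0%N, (fun=> 0).
  under eq_Rintegral do rewrite subrr normr0.
  by rewrite Rintegral_cst // mul0r ltW.
have [iF dF] := HF i.
rewrite (_ : (fun x => _) = fun x => F i x + \sum_(i <- s) F i x).
  by split; [exact: intgD|exact: step_denseD].
by apply/funext => x; rewrite big_cons.
Qed.

Lemma intg_step_dense h : intg mu h -> step_dense h.
Proof.
move=> ih; apply: step_dense_limit => // e e0.
have [g_ [ig_ _ cv]] := approximation_sfun_integrable measurableT ih.
have [k _ /(_ k (leqnn k)) /= lt] : \forall k \near \oo,
    (\int[mu]_z `|(EFin \o h) z - (g_ k z)%:E| < e%:E)%E.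
  apply: (cv [set y : \bar R | (y < e%:E)%E]).
  by apply: open_ereal_lt'; rewrite lte_fin.
have ig := ig_ k; exists (g_ k); split => //; last first.
  have i1 := intg_norm (intgB ih ig).
  by rewrite -lee_fin /Rintegral fineK ?ltW //; exact: integrable_fin_num.
pose vals := fset_set (g_ k @` setT).
rewrite (_ : (g_ k : R -> R) = fun x =>
    \sum_(i < #|` vals|) (vals`_i * \1_(g_ k @^-1` [set vals`_i]) x)).
  apply: (step_dense_sum _ _).2 => i.
  have mi : measurable (g_ k @^-1` [set vals`_i]).
    by rewrite -[_ @^-1` _]setTI; exact: measurable_funP.
  split; first by apply: intgZ; exact: intg_indic.
  by apply: step_denseZ; [exact: intg_indic|exact: step_dense_indic].
by apply/funext => x; rewrite [LHS]fimfunEord.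
Qed.

Lemma complex_step_dense (f : R -> R[i]) (e : R) : cintg mu f -> 0 < e ->
  exists q (c : seq bool -> R[i]), \int[mu]_x normc (f x - c (address q x)) <= e.
Proof.
move=> fi e0; have [ir ii] := fi; have e2 : 0 < e / 2 by lra.
have [q [c le1]] := intg_step_dense ir e2.
have [q' [c' le2]] := intg_step_dense ii e2.
pose C w : R[i] := c (drop q' w) +i* c' (drop q w).
exists (q' + q)%N, C.
have i1 := intg_norm (intgB ir (intg_step q c)).
have i2 := intg_norm (intgB ii (intg_step q' c')).
apply: (@le_trans _ _ (\int[mu]_x (`|Re (f x) - c (address q x)|
    + `|Im (f x) - c' (address q' x)|))).
  apply: le_Rintegral => //.
  - exact: cintg_normc (cintgB fi (cintg_step mu (q' + q) C)).
  - exact: intgD i1 i2.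
  - move=> x _; rewrite /C drop_address addnC drop_address.
    by apply: le_trans (normc_le _) _; case: (f x).
by rewrite RintegralD // [e]splitr lerD.
Qed.

End approximation.

(** * Almost everywhere convergence *)

Section convergence.
Context {R : realType} (mu : probability R R).
Hypothesis hmu : is_bernoulli_convolution (4^-1) mu.
Implicit Types (f g : R -> R[i]).

Lemma markov_normc f (a : R) : cintg mu f -> 0 < a ->
  measurable [set x | a < normc (f x)] /\
  (mu [set x | (a < normc (f x))%R] <= (a^-1 * \int[mu]_x normc (f x))%:E)%E.
Proof.
move=> fi a0; have iN := cintg_normc fi.
have mA : measurable [set x | a < normc (f x)].
  have := intg_measurable iN.
  move=> /(_ measurableT `]a, +oo[%classic (measurable_itv _)).
  by rewrite setTI; congr measurable; apply/seteqP; split => x /=; rewrite in_itv /= andbT.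
split => //; set A := [set x | _] in mA *.
have fin : mu A \is a fin_num by exact: fin_num_measure.
rewrite -(fineK fin) lee_fin mulrC ler_pdivlMr //.
have -> : fine (mu A) = \int[mu]_x \1_A x by rewrite /Rintegral integral_indic // setIT.
rewrite mulrC -RintegralZl //; last exact: intg_indic.
apply: le_Rintegral => //; first by apply: intgZ; exact: intg_indic.
move=> x _; rewrite indicE; case: (boolP (x \in A)) => [|_].
  by rewrite inE mulr1 => /ltW.
by rewrite mulr0 normc_ge0.
Qed.

Lemma negligible_small (B : set R) :
  (forall d : R, 0 < d -> exists W, [/\ measurable W, B `<=` W & (mu W <= d%:E)%E]) ->
  mu.-negligible B.
Proof.
move=> H.
have /choice[W HW] : forall n : nat, exists W, [/\ measurable W, B `<=` W &
    (mu W <= (2^-1 ^+ n)%:E)%E].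
  by move=> n; apply: H; rewrite exprn_gt0 // invr_gt0.
have mW : measurable (\bigcap_n W n).
  by apply: bigcap_measurable => // n _; have [] := HW n.
exists (\bigcap_n W n); split => //; last first.
  by move=> x Bx n _; have [_ sub _] := HW n; exact: sub.
have fin : mu (\bigcap_n W n) \is a fin_num by exact: fin_num_measure.
rewrite -(fineK fin); congr EFin; apply/eqP; rewrite eq_le fine_ge0 // andbT.
apply: (@le0_geometric _ _ 1 2^-1 0); first by apply/andP; split; lra.
move=> n _; rewrite mul1r -lee_fin fineK //.
have [mWn _ le] := HW n; apply: le_trans le; apply: le_measure; rewrite ?inE //.
exact: bigcap_inf.
Qed.

(** With [g] a step function close to [f], write [S_n f - f] as
    [S_n (f - g) + (S_n g - g) - (f - g)]: the middle term tends to 0, and the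
    other two are small off a set that the maximal and Markov inequalities
    bound by [243 / (e / 3)] times the L1 norm of [f - g]. *)
Lemma negligible_divergence f (e : R) : cintg mu f -> 0 < e ->
  mu.-negligible [set x | ~ exists N, forall n, (N <= n)%N ->
    normc (partial_sum mu f n x - f x) <= e].
Proof.
move=> fi e0; apply: negligible_small => d d0.
have e3 : 0 < e / 3 by lra.
pose K := 243 / (e / 3); have K0 : 0 < K by rewrite divr_gt0.
have [q [c le]] := complex_step_dense hmu fi (divr_gt0 d0 K0).
pose g (x : R) := c (address q x); have gi : cintg mu g by exact: cintg_step.
have hi := cintgB fi gi.
have /ae_foralln[N [mN N0 sN]] := cell_cover_ae hmu.
have [mA leA] := weak_type_maximal hmu hi e3.
have [mB leB] := markov_normc hi e3.
set A := [set x | (_ < `|_|)%E] in mA leA; set B := [set x | _] in mB leB.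
have mAB : measurable (A `|` B) by exact: measurableU.
exists (A `|` B `|` N); split.
- exact: measurableU.
- move=> x /= nconv; apply: contrapT => /not_orP[/not_orP[nA nB] nN].
  apply: nconv; have xc n : cell (address n x) x.
    by apply: contrapT => nx; apply: nN; apply: sN => /= /(_ n).
  have [C rate] := partial_sum_step_rate hmu q c xc.
  have [L0 HL0] : exists L0, forall L, (L0 <= L)%N -> C * (9 / 10) ^+ L <= e / 3.
    have cv : (fun L => C * (9 / 10) ^+ L) @ \oo --> C * 0.
      by apply: cvgMr; apply: cvg_expr; rewrite ger0_norm; lra.
    rewrite mulr0 in cv.
    have [L0 _ HL] : \forall L \near \oo, C * (9 / 10) ^+ L <= e / 3.
      by apply: (cvgr_le _ cv).
    by exists L0 => L; exact: HL.
  exists (L0 + q).+1 => n nL.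
  have nq : (q <= n)%N by apply: leq_trans nL; rewrite -addSn leq_addl.
  have r := rate (n - q)%N; rewrite subnK // in r.
  have L0n : (L0 <= n - q)%N by rewrite -(leq_add2r q) subnK // ltnW.
  have {}r := le_trans r (HL0 _ L0n).
  have s1 : normc (partial_sum mu (fun y => f y - g y) n x) <= e / 3.
    rewrite leNgt; apply/negP => lt; apply: nA.
    rewrite /A (maximal_gt_bigcup _ _ e3); case: n nL {nq r L0n} lt => // n _ lt.
    by exists n.
  have s2 : normc (f x - g x) <= e / 3.
    by rewrite leNgt; apply/negP.
  rewrite (partial_sumB n x fi gi) in s1.
  rewrite (_ : _ - f x = (partial_sum mu f n x - partial_sum mu g n x)
     + (partial_sum mu g n x - g x) + - (f x - g x)); last first.
    by ring.
  apply: le_trans (le_normcD _ _) _.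
  rewrite normcN [e](_ : _ = e / 3 + e / 3 + e / 3); last by field.
  apply: lerD s2; apply: le_trans (le_normcD _ _) _.
  exact: lerD.
- apply: le_trans (measureU2 _ mAB mN) _.
  rewrite [X in (_ + X <= _)%E](_ : _ = 0%E) ?adde0 //.
  apply: le_trans (measureU2 _ mA mB) _.
  apply: le_trans (leeD leA leB) _.
  rewrite L1normE // -EFinM -EFinD lee_fin.
  rewrite (_ : _ + _ = K * \int[mu]_x normc (f x - g x)); last first.
    by rewrite /K; field; rewrite gt_eqF.
  by rewrite mulrC -ler_pdivlMr.
Qed.

Lemma partial_sum_cvg_ae f : cintg mu f -> {ae mu, forall x,
  ((fun n => partial_sum mu f n x) : nat -> R[i]^o) @ \oo --> (f x : R[i]^o)}.
Proof.
move=> fi.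
have /ae_foralln : forall j : nat, {ae mu, forall x, exists N, forall n, (N <= n)%N ->
    normc (partial_sum mu f n x - f x) <= j.+1%:R^-1}.
  by move=> j; apply: negligible_divergence => //; rewrite invr_gt0.
apply: filterS => x H; apply/cvgrPdist_lt => -[a b].
rewrite ltcE /= => /andP[/eqP -> a0].
have [j ja] : exists j : nat, j.+1%:R^-1 < a.
  by have [j _ /(_ j (leqnn j))] := near_infty_natSinv_lt (PosNum a0); exists j.
have [N HN] := H j; exists N => // n /= Nn.
rewrite distrC normc_def ltcR; apply: le_lt_trans ja; apply: le_trans (HN _ Nn).
by case: (_ - _).
Qed.

End convergence.

Unset Implicit Arguments.

Theorem theorem1p3 (R : realType) (mu : probability R R)
    (hmu : is_bernoulli_convolution (4^-1) mu) :
  (exists C : R, 0 < C /\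
    forall f : R -> R[i], inL1 mu f ->
    forall alpha : R, 0 < alpha ->
      (mu [set x | alpha%:E < `|maximal_op mu f x|]
         <= (C / alpha)%:E * L1norm mu f)%E) /\
  (forall f : R -> R[i], inL1 mu f ->
    {ae mu, forall x, supp mu x ->
      ((fun n => partial_sum mu f n x) : nat -> R[i]^o) @ \oo
        --> (f x : R[i]^o)}).
Proof.
split.
  exists 242; split => // f /inL1_cintg fi al al0.
  exact: (weak_type_maximal hmu fi al0).2.
move=> f /inL1_cintg fi.
by apply: filterS (partial_sum_cvg_ae hmu fi).
Qed.
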